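(* Every Poisson-CGL extension $R$, with associated torus $\mathcal H$, is a noetherian $\mathcal H$-Poisson-UFD.
   Context: $\mathbb K$ is a field of characteristic $0$; algebras are $\mathbb K$-algebras, derivations are $\mathbb K$-linear; $[j,k]=\{j,\dots,k\}$. A Poisson algebra is a commutative algebra with a Lie bracket $\{-,-\}$ that is a derivation in each variable; a Poisson domain is a Poisson algebra that is an integral domain; a Poisson ideal is an ideal $I$ with $\{R,I\}\subseteq I$. A Poisson action of a group is an action by algebra automorphisms preserving the bracket. A Poisson derivation $\sigma$ of $B$ is a derivation for both product and bracket; a Poisson $\sigma$-derivation is a derivation $\delta$ for the product with $\delta(\{a,b\})=\{\delta(a),b\}+\{a,\delta(b)\}+\sigma(a)\delta(b)-\delta(a)\sigma(b)$. The Poisson-Ore extension $B[x;\sigma,\delta]_p$ is the polynomial algebra $B[x]$ with the unique Poisson bracket extending that of $B$ and satisfying $\{x,b\}=\sigma(b)x+\delta(b)$. For a rational action of a torus $\mathcal H\cong(\mathbb K^* )^r$ on an algebra, $\mathrm{Lie}\,\mathcal H\cong\mathbb K^r$ acts by the differential: if $a$ is an $\mathcal H$-eigenvector with eigenvalue $h\mapsto h_1^{u_1}\cdots h_r^{u_r}$, then $\xi\cdot a=(u_1\xi_1+\dots+u_r\xi_r)a$. A Poisson-prime element of a Poisson domain $R$ is a nonzero $c$ with $\{c,R\}\subseteq Rc$ and $R/(c)$ a domain. Given a Poisson action of a group $\mathcal H$ on $R$, an $\mathcal H$-Poisson-prime ideal is a proper $\mathcal H$-stable Poisson ideal $P$ such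 that $IJ\subseteq P$ implies $I\subseteq P$ or $J\subseteq P$ for all $\mathcal H$-stable Poisson ideals $I,J$. A Poisson domain $R$ with Poisson $\mathcal H$-action is an $\mathcal H$-Poisson-UFD if each nonzero $\mathcal H$-Poisson-prime ideal of $R$ contains a Poisson-prime $\mathcal H$-eigenvector. A Poisson-CGL extension of length $N$ is an iterated Poisson-Ore extension $R=\mathbb K[x_1]_p[x_2;\sigma_2,\delta_2]_p\cdots[x_N;\sigma_N,\delta_N]_p$ ($\sigma_1=\delta_1=0$; $R_k:=\mathbb K[x_1,\dots,x_k]$, $R_0=\mathbb K$) with a rational Poisson action of a torus $\mathcal H$ such that (i) each $x_k$ is an $\mathcal H$-eigenvector; (ii) for $k\in[2,N]$, $\delta_k$ is a locally nilpotent Poisson $\sigma_k$-derivation of $R_{k-1}$; (iii) for $k\in[1,N]$ there is $h_k\in\mathrm{Lie}\,\mathcal H$ with $\sigma_k=(h_k\cdot)|_{R_{k-1}}$ and the $h_k$-eigenvalue $\lambda_k$ of $x_k$ is nonzero. *)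

(* Defs.v *)
From HB Require Import structures.
From mathcomp Require Import all_boot all_algebra.
From mathcomp Require Export mpoly.

Set Implicit Arguments.
Unset Strict Implicit.
Unset Printing Implicit Defensive.

Import GRing.Theory.

Local Open Scope ring_scope.

(* Ideals, subalgebras, etc. are arbitrary (not necessarily decidable)
   subsets of the carrier, hence Prop-valued predicates. *)

Section CommutativeAlgebra.
Variable R : comNzRingType.

Record is_ideal (I : R -> Prop) : Prop := {
  ideal_zero : I 0;
  ideal_add : forall a b, I a -> I b -> I (a + b);
  ideal_mul : forall a b, I b -> I (a * b) }.

Definition noetherian : Prop :=
  forall I : R -> Prop, is_ideal I ->
    exists (m : nat) (g : 'I_m -> R),
      forall a, I a <-> exists c : 'I_m -> R, a = \sum_i c i * g i.

Definition principal (c : R) : R -> Prop := fun a => exists b, a = b * c.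

Definition ideal_prod (I J : R -> Prop) : R -> Prop := fun a =>
  exists (m : nat) (b c : 'I_m -> R),
    [/\ forall i, I (b i), forall i, J (c i) & a = \sum_i b i * c i].

Definition domain : Prop := forall a b : R, a * b = 0 -> a = 0 \/ b = 0.

(* This is "R / I is nonzero and has no zero divisors", written in R. *)
Definition quotient_domain (I : R -> Prop) : Prop :=
  ~ I 1 /\ forall a b, I (a * b) -> I a \/ I b.

End CommutativeAlgebra.

Section PoissonAlgebra.
Variables (K : fieldType) (R : comAlgType K) (br : R -> R -> R).

Record is_poisson : Prop := {
  br_linear_l : forall b, linear (br^~ b);
  br_linear_r : forall a, linear (br a);
  br_alternating : forall a, br a a = 0;
  br_jacobi : forall a b c, br a (br b c) + br b (br c a) + br c (br a b) = 0;
  br_leibniz_l : forall a b c, br (a * b) c = a * br b c + br a c * b;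
  br_leibniz_r : forall a b c, br a (b * c) = br a b * c + b * br a c }.

Definition poisson_domain : Prop := is_poisson /\ domain R.

Record is_poisson_ideal (I : R -> Prop) : Prop := {
  poisson_ideal_ideal : is_ideal I;
  poisson_ideal_br : forall a b, I b -> I (br a b) }.

Record poisson_prime_elt (c : R) : Prop := {
  poisson_prime_neq0 : c != 0;
  poisson_prime_br : forall a, principal c (br c a);
  poisson_prime_domain : quotient_domain (principal c) }.

(* Maps defined on a subset B of R are represented by maps R -> R of which
   only the restriction to B matters. *)

Record derivation_on (B : {pred R}) (f : R -> R) : Prop := {
  deriv_stable : forall a, a \in B -> f a \in B;
  deriv_linear : forall (s : K) a b, a \in B -> b \in B ->
    f (s *: a + b) = s *: f a + f b;
  deriv_mul : forall a b, a \in B -> b \in B ->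
    f (a * b) = f a * b + a * f b }.

Record poisson_derivation_on (B : {pred R}) (sigma : R -> R) : Prop := {
  pderiv_derivation : derivation_on B sigma;
  pderiv_br : forall a b, a \in B -> b \in B ->
    sigma (br a b) = br (sigma a) b + br a (sigma b) }.

Record poisson_skew_derivation_on
    (B : {pred R}) (sigma delta : R -> R) : Prop := {
  skew_derivation : derivation_on B delta;
  skew_br : forall a b, a \in B -> b \in B ->
    delta (br a b) = br (delta a) b + br a (delta b)
                     + sigma a * delta b - delta a * sigma b }.

Definition locally_nilpotent_on (B : {pred R}) (f : R -> R) : Prop :=
  forall a, a \in B -> exists n, iter n f a = 0.

(* For a subalgebra B of R over which x is a polynomial variable: the Poisson
   structure induced on B[x] is that of B[x; sigma, delta]_p. *)
Record poisson_ore
    (B : {pred R}) (x : R) (sigma delta : R -> R) : Prop := {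
  ore_base : forall a b, a \in B -> b \in B -> br a b \in B;
  ore_sigma : poisson_derivation_on B sigma;
  ore_delta : poisson_skew_derivation_on B sigma delta;
  ore_br : forall b, b \in B -> br x b = sigma b * x + delta b }.

Section Action.
Variables (G : groupType) (act : G -> R -> R).

Record is_poisson_action : Prop := {
  act_one : forall a, act 1%g a = a;
  act_mul : forall g h a, act (g * h)%g a = act g (act h a);
  act_linear : forall g, linear (act g);
  act_ring1 : forall g, act g 1 = 1;
  act_ringM : forall g a b, act g (a * b) = act g a * act g b;
  act_br : forall g a b, act g (br a b) = br (act g a) (act g b) }.

Definition eigenvector (a : R) : Prop :=
  a != 0 /\ exists chi : G -> K, forall g, act g a = chi g *: a.

Definition stable_poisson_ideal (I : R -> Prop) : Prop :=
  is_poisson_ideal I /\ forall g a, I a -> I (act g a).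

Record H_poisson_prime (P : R -> Prop) : Prop := {
  Hprime_ideal : stable_poisson_ideal P;
  Hprime_proper : exists a, ~ P a;
  Hprime_prod : forall I J : R -> Prop,
    stable_poisson_ideal I -> stable_poisson_ideal J ->
    (forall a, ideal_prod I J a -> P a) ->
    (forall a, I a -> P a) \/ (forall a, J a -> P a) }.

Record H_poisson_UFD : Prop := {
  UFD_domain : poisson_domain;
  UFD_action : is_poisson_action;
  UFD_prime : forall P : R -> Prop, H_poisson_prime P ->
    (exists2 a, P a & a != 0) ->
    exists c, [/\ P c, poisson_prime_elt c & eigenvector c] }.

End Action.

End PoissonAlgebra.

Section MultiplicativeGroup.
Variable K : fieldType.

Record Kstar : Type := MkKstar { kval :> K; kvalP : kval != 0 }.

HB.instance Definition _ := [isSub for kval].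
HB.instance Definition _ := [Choice of Kstar by <:].

Definition Kstar_mul (x y : Kstar) : Kstar :=
  MkKstar (mulf_neq0 (kvalP x) (kvalP y)).
Definition Kstar_one : Kstar := MkKstar (oner_neq0 K).
Fact Kstar_inv_subproof (x : Kstar) : (kval x)^-1 != 0.
Proof. by rewrite invr_eq0 kvalP. Qed.
Definition Kstar_inv (x : Kstar) : Kstar := MkKstar (Kstar_inv_subproof x).

Fact Kstar_mulA : associative Kstar_mul.
Proof. by move=> x y z; apply: val_inj; exact: mulrA. Qed.
Fact Kstar_mul1 : left_id Kstar_one Kstar_mul.
Proof. by move=> x; apply: val_inj; exact: mul1r. Qed.
Fact Kstar_mulr1 : right_id Kstar_one Kstar_mul.
Proof. by move=> x; apply: val_inj; exact: mulr1. Qed.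
Fact Kstar_mulV : left_inverse Kstar_one Kstar_inv Kstar_mul.
Proof. by move=> x; apply: val_inj; exact: mulVf (kvalP x). Qed.
Fact Kstar_mulrV : right_inverse Kstar_one Kstar_inv Kstar_mul.
Proof. by move=> x; apply: val_inj; exact: mulfV (kvalP x). Qed.

HB.instance Definition _ :=
  isGroup.Build Kstar Kstar_mulA Kstar_mul1 Kstar_mulr1 Kstar_mulV Kstar_mulrV.

End MultiplicativeGroup.

Definition torus (K : fieldType) (r : nat) : groupType := {ffun 'I_r -> Kstar K}.

Section TorusAction.
Variables (K : fieldType) (r : nat).

Definition torus_char (u : {ffun 'I_r -> int}) (h : {ffun 'I_r -> Kstar K}) : K :=
  \prod_i (kval (h i)) ^ (u i).

(* The coordinate ring of the torus is the Laurent polynomial ring. *)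
Definition torus_regular (f : torus K r -> K) : Prop :=
  exists (m : nat) (c : 'I_m -> K) (u : 'I_m -> {ffun 'I_r -> int}),
    forall h, f h = \sum_j c j * torus_char (u j) h.

Variables (R : lmodType K) (act : torus K r -> R -> R).

(* R is the union of finite-dimensional stable subspaces (with basis v) on
   which H -> GL is a morphism of algebraic groups. *)
Definition rational_action : Prop :=
  forall a : R, exists (m : nat) (v : 'I_m -> R) (M : torus K r -> 'M[K]_m),
    [/\ forall c : 'I_m -> K, \sum_i c i *: v i = 0 -> forall i, c i = 0,
        exists c : 'I_m -> K, a = \sum_i c i *: v i,
        forall i j, torus_regular (fun h => M h i j)
      & forall h j, act h (v j) = \sum_i M h i j *: v i].

Definition weight_vector (u : {ffun 'I_r -> int}) (a : R) : Prop :=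
  forall h, act h a = torus_char u h *: a.

(* D is the action of xi in Lie H = K^r; for a rational action there is
   exactly one such D, because R is spanned by its weight vectors. *)
Definition lie_action (xi : 'rV[K]_r) (D : {linear R -> R}) : Prop :=
  forall u a, weight_vector u a -> D a = (\sum_i (u i)%:~R * xi 0 i) *: a.

End TorusAction.

Section CGL.
Variables (K : fieldType) (N r : nat).

(* The subalgebra R_k of polynomials in the first k variables 'X_0 .. 'X_{k-1};
   indices being 0-based, R_{k+1} is the polynomial algebra R_k['X_k]. *)
Definition poly_sub (k : nat) : {pred {mpoly K[N]}} :=
  [pred p : {mpoly K[N]} |
    all (fun m : 'X_{1..N} => [forall i : 'I_N, (k <= i)%N ==> (m i == 0%N)])
        (msupp p)].

Record poisson_CGL
    (br : {mpoly K[N]} -> {mpoly K[N]} -> {mpoly K[N]})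
    (sigma delta : 'I_N -> {mpoly K[N]} -> {mpoly K[N]})
    (act : torus K r -> {mpoly K[N]} -> {mpoly K[N]}) : Prop := {
  CGL_poisson : is_poisson br;
  CGL_ore : forall k : 'I_N,
    poisson_ore br (poly_sub k) 'X_k (sigma k) (delta k);
  CGL_first : forall k : 'I_N, nat_of_ord k = 0%N ->
    forall b, b \in poly_sub k -> sigma k b = 0 /\ delta k b = 0;
  CGL_action : is_poisson_action br act;
  CGL_rational : rational_action act;
  CGL_eigen : forall k : 'I_N, eigenvector act 'X_k;
  CGL_nilpotent : forall k : 'I_N, (0 < k)%N ->
    locally_nilpotent_on (poly_sub k) (delta k);
  CGL_lie : forall k : 'I_N,
    exists (xi : 'rV[K]_r) (D : {linear {mpoly K[N]} -> {mpoly K[N]}}),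
      [/\ lie_action act xi D,
          forall b, b \in poly_sub k -> sigma k b = D b
        & exists2 lambda : K, lambda != 0 & D 'X_k = lambda *: 'X_k] }.

End CGL.

(* Main.v *)
From HB Require Import structures.
Require Import Defs.
From mathcomp Require Import all_boot all_algebra.
From mathcomp Require Import ring.
From Stdlib Require Import Classical.

Set Implicit Arguments.
Unset Strict Implicit.
Unset Printing Implicit Defensive.

Import GRing.Theory.

Local Open Scope ring_scope.

(** An iterated Poisson-Ore extension is a polynomial algebra, so it is
    noetherian by Hilbert's basis theorem ([hilbert_step]). For the UFD property
    the statement to prove by induction along the tower is: every nonzero
    H-stable Poisson ideal of R_k contains a product of Poisson-prime
    eigenvectors ([meets_prime_products]). It gives the theorem, because for a
    Poisson-prime eigenvector c both (c) and the colon ideal (P : c) are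
    H-stable Poisson ideals whose product lies in P; hence an H-Poisson-prime
    ideal P containing a product of such elements contains one of them.

    The inductive step ([ore_step]) passes from B to R = B[x; sigma, delta]_p.
    Let h be the derivation of R by which the element of Lie H acts, so that
    sigma = h on B and h x = lam x with lam nonzero. On R[x^-1] the operator
    E = h - x^-1 {x, -} is a derivation for the product and for the bracket,
    with E x = lam x and E b = - delta(b) x^-1 for b in B. Local nilpotence of
    delta makes R[x^-1] the direct sum of the eigenspaces of E for the
    eigenvalues m lam, and taking the coefficient of x^m identifies the m-th
    eigenspace with B. So R[x^-1] is a Laurent extension, without delta-term,
    of a copy of B: this is Cauchon's deletion of derivations. The proof stays
    inside R. There [hom m f] says that f lies in the m-th eigenspace, and
    [symbol m f b] that b is moreover its coefficient of x^m.

    Let P be a nonzero H-stable Poisson ideal of R. The operators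
    x (E - m lam) preserve P and act nilpotently on elements of degree at most
    m, so P contains a nonzero eigenvector of E ([stable_has_hom]). The symbols
    of the eigenvectors of P form an ideal of B of the same kind
    ([symbol_idealP]), which by induction contains a product of Poisson-primes
    a_i. Each a_i is the symbol of some c_i in R that x does not divide, and c_i
    is Poisson-prime in R because a_i is so in B ([lift_prime]). Therefore
    x^n c lies in P for c the product of the c_i and some n.

    If delta = 0 then x is itself Poisson-prime. Otherwise x^n belongs to the
    colon ideal J = (P : c), and bracketing with an element b such that delta(b)
    is nonzero replaces powers of x by powers of e = delta(b), until some e^k
    lies in J ([power_in_ideal]). So the intersection of J with B is nonzero; it
    is delta-stable, and by induction it contains a product of Poisson-primes
    of B. The lift of that product to an eigenvector has all its coefficients
    in J, which puts a product c' of Poisson-primes of R in J, and c' c in P.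

    The torus enters through the linear independence of characters
    ([character_separation]): the variables are weight vectors for algebraic
    characters ([eigenvector_weight]), and an H-stable subspace contains the
    weight components of its elements, hence is stable under Lie H
    ([lie_stable]). *)

(** * Stable Poisson ideals and Poisson-prime eigenvectors *)

(** All subalgebras of the tower live in one ambient algebra, and ideals of the
    subalgebra [S] are subsets of the ambient algebra. *)
Section StableIdeals.
Variables (K : fieldType) (A : comAlgType K) (br : A -> A -> A).
Variables (G : groupType) (act : G -> A -> A).

Definition divides (S : {pred A}) (c a : A) : Prop :=
  exists2 b, b \in S & a = b * c.

Record stable_ideal (S : {pred A}) (I : A -> Prop) : Prop := {
  stable_sub : forall a, I a -> a \in S;
  stable0 : I 0;
  stableD : forall a b, I a -> I b -> I (a + b);
  stableM : forall a b, a \in S -> I b -> I (a * b);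
  stable_br : forall a b, a \in S -> I b -> I (br a b);
  stable_act : forall g a, I a -> I (act g a) }.

Record normal_eigen (S : {pred A}) (c : A) : Prop := {
  normal_in : c \in S;
  normal_br : forall a, a \in S -> divides S c (br c a);
  normal_act : exists chi : G -> K, forall g, act g c = chi g *: c }.

Record prime_eigen (S : {pred A}) (c : A) : Prop := {
  prime_normal : normal_eigen S c;
  prime_neq0 : c != 0;
  prime_proper : ~ divides S c 1;
  prime_mul : forall a b, a \in S -> b \in S ->
    divides S c (a * b) -> divides S c a \/ divides S c b }.

Definition prime_product (S : {pred A}) (a : A) : Prop :=
  exists2 s : seq A, (forall c, c \in s -> prime_eigen S c)
                   & a = \prod_(c <- s) c.

(** The property carried along the tower. The empty product is allowed, so an
    ideal containing 1 satisfies it. *)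
Definition meets_prime_products (S : {pred A}) : Prop :=
  forall I, stable_ideal S I -> (exists2 a, I a & a != 0) ->
    exists2 a, I a & prime_product S a.

Section Bracket.
Hypothesis brP : is_poisson br.

Lemma brDr a b c : br a (b + c) = br a b + br a c.
Proof. by have := br_linear_r brP a 1 b c; rewrite !scale1r. Qed.

Lemma brDl a b c : br (a + b) c = br a c + br b c.
Proof. by have := br_linear_l brP c 1 a b; rewrite !scale1r. Qed.

Lemma br0r a : br a 0 = 0.
Proof. by have := br_linear_r brP a (-1) 0 0; rewrite !scaleN1r addr0 oppr0 addNr. Qed.

Lemma br0l a : br 0 a = 0.
Proof. by have := br_linear_l brP a (-1) 0 0; rewrite !scaleN1r addr0 oppr0 addNr. Qed.

Lemma brZr k a b : br a (k *: b) = k *: br a b.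
Proof. by have := br_linear_r brP a k b 0; rewrite br0r !addr0. Qed.

Lemma brZl k a b : br (k *: a) b = k *: br a b.
Proof. by have := br_linear_l brP b k a 0; rewrite br0l !addr0. Qed.

Lemma brC a b : br a b = - br b a.
Proof.
apply/eqP; rewrite -addr_eq0; apply/eqP.
have := br_alternating brP (a + b).
by rewrite brDl !brDr !(br_alternating brP) add0r addr0.
Qed.

Lemma brMr a b c : br a (b * c) = br a b * c + b * br a c.
Proof. exact: br_leibniz_r. Qed.

Lemma brMl a b c : br (a * b) c = a * br b c + br a c * b.
Proof. exact: br_leibniz_l. Qed.

Lemma br1r a : br a 1 = 0.
Proof.
have := brMr a 1 1; rewrite !mulr1 mul1r => /eqP.
by rewrite -{1}[br a 1]addr0 (inj_eq (addrI _)) => /eqP.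
Qed.

Lemma br_algr a k : br a k%:A = 0.
Proof. by rewrite brZr br1r scaler0. Qed.

End Bracket.

Section Action.
Hypothesis actP : is_poisson_action br act.

Lemma act0 g : act g 0 = 0.
Proof. by have := act_linear actP g (-1) 0 0; rewrite !scaleN1r !addNr. Qed.

Lemma actZ g k a : act g (k *: a) = k *: act g a.
Proof. by have := act_linear actP g k a 0; rewrite act0 !addr0. Qed.

Lemma actD g a b : act g (a + b) = act g a + act g b.
Proof. by have := act_linear actP g 1 a b; rewrite !scale1r. Qed.

Lemma actN g a : act g (- a) = - act g a.
Proof. by rewrite -scaleN1r actZ scaleN1r. Qed.

Lemma act_sum g (I : Type) (s : seq I) (F : I -> A) :
  act g (\sum_(i <- s) F i) = \sum_(i <- s) act g (F i).
Proof.
by elim: s => [|i s IHs]; rewrite ?big_nil ?act0 // !big_cons actD IHs.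
Qed.

Lemma act_eq0 g a : act g a = 0 -> a = 0.
Proof. by move=> ga0; rewrite -(act_one actP a) -(mulVg g) (act_mul actP) ga0 act0. Qed.

End Action.

Section Closure.
Hypotheses (brP : is_poisson br) (actP : is_poisson_action br act).
Variable S : subringClosed A.
Hypothesis S_alg : forall k : K, k%:A \in S.
Hypothesis S_act : forall g a, a \in S -> act g a \in S.
Hypothesis S_br : forall a b, a \in S -> b \in S -> br a b \in S.

Lemma stableZ I : stable_ideal S I -> forall (k : K) a, I a -> I (k *: a).
Proof.
move=> SI k a Ia; rewrite -mulr_algl; exact: (stableM SI) Ia.
Qed.

Lemma stableN I : stable_ideal S I -> forall a, I a -> I (- a).
Proof. by move=> SI a Ia; rewrite -scaleN1r; apply: stableZ. Qed.

Lemma stable_brl I : stable_ideal S I -> forall a b, a \in S -> I b -> I (br b a).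
Proof. by move=> SI a b Sa Ib; rewrite brC //; apply: (stableN SI); apply: (stable_br SI). Qed.

Lemma divides0 c : divides S c 0.
Proof. by exists 0; rewrite ?rpred0 ?mul0r. Qed.

Lemma dividesD c f g : divides S c f -> divides S c g -> divides S c (f + g).
Proof. by move=> [u Ru ->] [v Rv ->]; exists (u + v); rewrite ?rpredD ?mulrDl. Qed.

Lemma dividesMl c f g : f \in S -> divides S c g -> divides S c (f * g).
Proof. by move=> Rf [v Rv ->]; exists (f * v); rewrite ?rpredM ?mulrA. Qed.

Lemma dividesN c g : divides S c g -> divides S c (- g).
Proof. by move=> [v Rv ->]; exists (- v); rewrite ?rpredN ?mulNr. Qed.

Lemma normal_eigen1 : normal_eigen S 1.
Proof.
split; first exact: rpred1.
  move=> a Sa; exists 0; first exact: rpred0.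
  by rewrite brC // br1r // oppr0 mul0r.
by exists (fun=> 1) => g; rewrite (act_ring1 actP) scale1r.
Qed.

Lemma normal_eigenM a b :
  normal_eigen S a -> normal_eigen S b -> normal_eigen S (a * b).
Proof.
move=> [Sa bra [chia acta]] [Sb brb [chib actb]]; split; first exact: rpredM.
  move=> c Sc; have [u Su eu] := bra c Sc; have [v Sv ev] := brb c Sc.
  exists (u + v); first exact: rpredD.
  by rewrite brMl // eu ev; ring.
exists (fun g => chia g * chib g) => g.
by rewrite (act_ringM actP) acta actb -scalerAl -scalerAr scalerA.
Qed.

Lemma normal_eigen_prod s : (forall c, c \in s -> prime_eigen S c) ->
  normal_eigen S (\prod_(c <- s) c).
Proof.
elim: s => [|c s IHs] s_prime; first by rewrite big_nil; apply: normal_eigen1.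
rewrite big_cons; apply: normal_eigenM.
  by apply/prime_normal/s_prime; rewrite mem_head.
by apply: IHs => d sd; apply: s_prime; rewrite inE sd orbT.
Qed.

Lemma prime_productM a b :
  prime_product S a -> prime_product S b -> prime_product S (a * b).
Proof.
move=> [s sP ->] [t tP ->]; exists (s ++ t); last by rewrite big_cat.
by move=> c; rewrite mem_cat => /orP[/sP|/tP].
Qed.

(** Stability under the bracket holds because
    {a, b} c = {a, b c} - b {a, c} and {a, c} is a multiple of c. *)
Lemma stable_colon I c : stable_ideal S I -> normal_eigen S c ->
  stable_ideal S (fun a => a \in S /\ I (a * c)).
Proof.
move=> SI [Sc brc [chi actc]]; split.
- by move=> a [].
- by rewrite rpred0 mul0r; split=> //; apply: (stable0 SI).
- move=> a b [Sa Ia] [Sb Ib]; rewrite rpredD // mulrDl; split=> //.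
  exact: (stableD SI).
- by move=> a b Sa [Sb Ib]; rewrite rpredM // -mulrA; split=> //; apply: (stableM SI).
- move=> a b Sa [Sb Ib]; split; first exact: S_br.
  have [u Su eu] := brc a Sa.
  have -> : br a b * c = br a (b * c) + u * (b * c).
    by rewrite brMr // [br a c]brC // eu; ring.
  by apply: (stableD SI); [apply: (stable_br SI)|apply: (stableM SI)].
move=> g a [Sa Ia]; split; first exact: S_act.
have -> : act g a * c = act g (a * act g^-1%g c).
  by rewrite (act_ringM actP) -(act_mul actP) mulgV (act_one actP).
by rewrite actc -scalerAr; apply: (stable_act SI); apply: stableZ.
Qed.

Lemma stable_principal c : normal_eigen S c -> stable_ideal S (divides S c).
Proof.
move=> [Sc brc [chi actc]]; split.
- by move=> _ [b Sb ->]; apply: rpredM.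
- exact: divides0.
- exact: dividesD.
- exact: dividesMl.
- move=> a _ Sa [b Sb ->]; have [u Su eu] := brc a Sa.
  exists (br a b - b * u); first by rewrite rpredB ?rpredM ?S_br.
  by rewrite brMr // [br a c]brC // eu; ring.
move=> g _ [b Sb ->]; exists (chi g *: act g b); first by rewrite -mulr_algl rpredM // S_act.
by rewrite (act_ringM actP) actc -scalerAl -scalerAr.
Qed.

End Closure.
End StableIdeals.

(** * Polynomials with coefficients in a subring *)
Section PolyTop.
Variable A : comNzRingType.

Lemma coefM_top (p q : {poly A}) m n :
  (size p <= m.+1)%N -> (size q <= n.+1)%N -> (p * q)`_(m + n) = p`_m * q`_n.
Proof.
move=> sp sq; have lt_m : (m < (m + n).+1)%N by rewrite ltnS leq_addr.
rewrite coefM (bigD1 (Ordinal lt_m)) //= addKn big1 ?addr0 // => -[i i_lt] /=.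
rewrite -val_eqE /= neq_ltn => /orP[lt_im|lt_mi].
  by rewrite [q`__]nth_default ?mulr0 // (leq_trans sq) // ltn_subRL ltn_add2r.
by rewrite [p`__]nth_default ?mul0r // (leq_trans sp).
Qed.

Lemma lead_coef_mul (p q : {poly A}) : domain A -> p != 0 -> q != 0 ->
  lead_coef (p * q) = lead_coef p * lead_coef q.
Proof.
move=> A_dom; rewrite -!lead_coef_eq0 => p0 q0; apply: lead_coef_proper_mul.
by apply/eqP=> /A_dom[e|e]; rewrite e eqxx in p0 q0.
Qed.

Lemma polyOver_ind (B : subringClosed A) (P : {poly A} -> Prop) :
  P 0 -> (forall p c, p \is a polyOver B -> c \in B -> P p -> P (p * 'X + c%:P)) ->
  forall p, p \is a polyOver B -> P p.
Proof.
move=> P0 PS; elim/poly_ind => [//|p c IHp] /polyOverP pB.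
have Bp : p \is a polyOver B.
  by apply/polyOverP=> i; have := pB i.+1; rewrite coefD coefMX coefC /= addr0.
have Bc : c \in B by have := pB 0; rewrite coefD coefMX coefC /= add0r.
exact: PS (IHp Bp).
Qed.

End PolyTop.

(** * Adjoining one variable *)

(** The section describes R = B[x; h, d]_p by hypotheses on subrings of an
    ambient algebra: [R_poly] and [x_free] say that R is the polynomial ring
    B[x], and [h] is the action of an element of Lie H on the whole ambient
    algebra. The torus is an arbitrary group G here; what is used of the link
    between G and [h] is that subspaces stable under G are stable under [h]. *)
Section OreStep.
Variables (K : fieldType) (A : comAlgType K) (br : A -> A -> A).
Variables (G : groupType) (act : G -> A -> A).
Hypotheses (charK0 : [pchar K] =i pred0) (A_dom : domain A).
Hypotheses (brP : is_poisson br) (actP : is_poisson_action br act).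
Variables (B R : subringClosed A) (x : A).
Hypothesis B_alg : forall k : K, k%:A \in B.
Hypothesis B_act : forall g b, b \in B -> act g b \in B.
Hypothesis R_act : forall g f, f \in R -> act g f \in R.
Hypothesis sBR : {subset B <= R}.
Hypothesis xR : x \in R.
Hypothesis R_poly : forall f, f \in R -> exists2 p, p \is a polyOver B & f = p.[x].
Hypothesis x_free : forall p, p \is a polyOver B -> p.[x] = 0 -> p = 0.
Variables (h : {linear A -> A}) (d : A -> A) (lam : K).
Hypothesis hM : forall a b, h (a * b) = h a * b + a * h b.
Hypothesis h_br : forall a b, h (br a b) = br (h a) b + br a (h b).
Hypothesis h_act : forall g a, h (act g a) = act g (h a).
Hypothesis h_stable : forall V : A -> Prop,
  (forall (k : K) a b, V a -> V b -> V (k *: a + b)) ->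
  (forall g a, V a -> V (act g a)) -> forall a, V a -> V (h a).
Hypothesis B_br : forall a b, a \in B -> b \in B -> br a b \in B.
Hypothesis dP : derivation_on B d.
Hypothesis d_nil : locally_nilpotent_on B d.
Hypothesis x_br : forall b, b \in B -> br x b = h b * x + d b.
Hypothesis lam_neq0 : lam != 0.
Hypothesis hx : h x = lam *: x.
Variable chix : G -> K.
Hypothesis x_act : forall g, act g x = chix g *: x.

(** Scalars are written as elements of the ambient algebra behind a constant,
    so that ring identities involving them are identities of commutative ring
    expressions. *)
Definition scal (k : K) : A := k%:A.
Lemma B_scal k : scal k \in B. Proof. exact: B_alg. Qed.
Lemma scaleE k a : k *: a = scal k * a. Proof. by rewrite mulr_algl. Qed.
Local Notation L := (scal lam).

Lemma R_alg (k : K) : k%:A \in R. Proof. exact/sBR. Qed.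

Lemma B_Z (k : K) b : b \in B -> k *: b \in B.
Proof. by move=> Bb; rewrite -mulr_algl rpredM. Qed.

Lemma R_Z (k : K) b : b \in R -> k *: b \in R.
Proof. by move=> Bb; rewrite -mulr_algl rpredM ?R_alg. Qed.

Lemma d0 : d 0 = 0.
Proof.
have := deriv_linear dP (-1) (rpred0 B) (rpred0 B).
by rewrite !scaleN1r addNr addNr.
Qed.

Lemma dZ k a : a \in B -> d (k *: a) = k *: d a.
Proof. by move=> Ba; have := deriv_linear dP k Ba (rpred0 B); rewrite d0 !addr0. Qed.

Lemma d_in a : a \in B -> d a \in B. Proof. exact: deriv_stable. Qed.

Lemma iter_d_in n a : a \in B -> iter n d a \in B.
Proof. by move=> Ba; elim: n => //= n; apply: d_in. Qed.

Lemma iter_dZ n k a : a \in B -> iter n d (k *: a) = k *: iter n d a.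
Proof. by move=> Ba; elim: n => //= n ->; rewrite dZ // iter_d_in. Qed.

Lemma h1 : h 1 = 0.
Proof.
have := hM 1 1; rewrite !mulr1 mul1r => /eqP.
by rewrite -{1}[h 1]addr0 (inj_eq (addrI _)) => /eqP.
Qed.

Lemma h_in a : a \in B -> h a \in B.
Proof.
apply: (h_stable (V := fun a => a \in B)); last exact: B_act.
by move=> k b c Bb Bc; rewrite rpredD ?B_Z.
Qed.

Lemma h_x : h x = L * x. Proof. by rewrite hx scaleE. Qed.

Lemma br_scal a k : br a (scal k) = 0. Proof. exact: br_algr. Qed.
Lemma br_nat a n : br a n%:R = 0. Proof. by rewrite -scaler_nat br_algr. Qed.

Lemma act_scal g k : act g (scal k) = scal k.
Proof. by rewrite /scal (actZ actP) (act_ring1 actP). Qed.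

Lemma act_nat g n : act g n%:R = n%:R.
Proof. by rewrite -scaler_nat (actZ actP) (act_ring1 actP). Qed.

Lemma natr_neq0 n : (n.+1%:R : K) != 0.
Proof. by have /pcharf0P -> := charK0. Qed.

Lemma scale_eq0 (k : K) (a : A) : k != 0 -> k *: a = 0 -> a = 0.
Proof. by move=> k0 ka; rewrite -[a]scale1r -(mulVf k0) -scalerA ka scaler0. Qed.

Local Notation d_poly := (map_poly d).
Local Notation h_poly := (map_poly h).
Definition horner_evalE := (hornerD, hornerN, hornerX, hornerC, hornerM).

Lemma coef_d p i : (d_poly p)`_i = d p`_i. Proof. exact: coef_map_id0 d0. Qed.

Lemma d_polyOver p : p \is a polyOver B -> d_poly p \is a polyOver B.
Proof. by move/polyOverP=> pB; apply/polyOverP=> i; rewrite coef_d d_in. Qed.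

Lemma h_polyOver p : p \is a polyOver B -> h_poly p \is a polyOver B.
Proof.
by move/polyOverP=> pB; apply/polyOverP=> i; rewrite coef_map h_in.
Qed.

Lemma horner_in p : p \is a polyOver B -> p.[x] \in R.
Proof.
elim/(polyOver_ind (B := B)): p /; first by rewrite horner0 rpred0.
by move=> p c _ Bc IHp; rewrite hornerMXaddC rpredD ?rpredM // sBR.
Qed.

Lemma horner_inj p q : p \is a polyOver B -> q \is a polyOver B ->
  p.[x] = q.[x] -> p = q.
Proof.
move=> Bp Bq epq; apply/eqP; rewrite -subr_eq0; apply/eqP/x_free.
  exact: rpredB.
by rewrite hornerD hornerN epq subrr.
Qed.

Lemma map_polyMXaddC (f : A -> A) p c : f 0 = 0 ->
  map_poly f (p * 'X + c%:P) = map_poly f p * 'X + (f c)%:P.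
Proof.
move=> f0; apply/polyP=> -[|i]; rewrite coef_map_id0 // !coefD !coefMX !coefC /= ?add0r //.
by rewrite !addr0 coef_map_id0.
Qed.

Lemma map_poly_0 (f : A -> A) : map_poly f 0 = 0.
Proof. by rewrite map_polyE polyseq0. Qed.

Lemma h_horner p : p \is a polyOver B ->
  h p.[x] = (h_poly p).[x] + L * x * p^`().[x].
Proof.
elim/(polyOver_ind (B := B)): p /.
  by rewrite map_poly_0 deriv0 !horner0 linear0 mulr0 addr0.
move=> p c _ Bc IHp; rewrite map_polyMXaddC ?linear0 // derivD derivM.
rewrite derivC derivX !horner_evalE linearD hM IHp h_x /=; ring.
Qed.

Lemma x_br_horner p : p \is a polyOver B ->
  br x p.[x] = (h_poly p).[x] * x + (d_poly p).[x].
Proof.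
elim/(polyOver_ind (B := B)): p /.
  by rewrite !map_poly_0 !horner0 mul0r add0r (br0r brP).
move=> p c _ Bc IHp; rewrite !map_polyMXaddC ?linear0 ?d0 //.
rewrite !horner_evalE (brDr brP) // (brMr brP) // IHp (br_alternating brP) x_br //; ring.
Qed.

Lemma br_horner_base p b : p \is a polyOver B -> b \in B ->
  br p.[x] b = (map_poly (br^~ b) p).[x] + p^`().[x] * (h b * x + d b).
Proof.
move=> + Bb; elim/(polyOver_ind (B := B)): p /.
  by rewrite map_poly_0 deriv0 !horner0 mul0r addr0 (br0l brP).
move=> p c _ Bc IHp; rewrite map_polyMXaddC ?(br0l brP) // derivD derivM.
rewrite derivC derivX !horner_evalE (brDl brP) // (brMl brP) // IHp x_br //; ring.
Qed.

(** The bracket of B extended bilinearly to B[X] with X central: the part of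
    the bracket of two polynomials in x that does not involve brackets with x. *)
Definition coefficient_br (p q : {poly A}) : {poly A} :=
  \sum_(j < size q) map_poly (br^~ q`_j) p * 'X^j.

Lemma coefficient_brMXaddC p q c :
  coefficient_br p (q * 'X + c%:P) = coefficient_br p q * 'X + map_poly (br^~ c) p.
Proof.
have wide (r : {poly A}) n : (size r <= n)%N ->
    coefficient_br p r = \sum_(j < n) map_poly (br^~ r`_j) p * 'X^j.
  move=> sr; rewrite /coefficient_br (big_ord_widen n (fun j => map_poly (br^~ r`_j) p * 'X^j)) //.
  rewrite big_mkcond; apply: eq_bigr => j _; case: ltnP => // sj.
  rewrite nth_default // (_ : map_poly _ p = 0) ?mul0r //.
  by apply/polyP=> i; rewrite coef_map_id0 ?(br0r brP) // coef0.
rewrite (wide _ (size q).+1); last first.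
  rewrite (leq_trans (size_polyD _ _)) // geq_max size_polyC.
  rewrite (leq_trans (size_polyMleq _ _)) ?size_polyX ?addn2 //.
  by case: eqP.
rewrite big_ord_recl expr0 mulr1 addrC (wide q (size q)) // mulr_suml.
congr (_ + _).
  apply: eq_bigr => j _; rewrite coefD coefMX coefC /= addr0 exprSr mulrA.
  by [].
by rewrite coefD coefMX coefC /= add0r.
Qed.

Lemma br_horner_expand p q : p \is a polyOver B -> q \is a polyOver B ->
  br p.[x] q.[x] = (coefficient_br p q).[x]
    + p^`().[x] * ((h_poly q).[x] * x + (d_poly q).[x])
    - q^`().[x] * ((h_poly p).[x] * x + (d_poly p).[x]).
Proof.
move=> Bp; elim/(polyOver_ind (B := B)): q /.
  rewrite /coefficient_br size_poly0 big_ord0 !map_poly_0 deriv0 !horner0.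
  by rewrite (br0r brP) !mul0r !add0r mulr0 subr0.
move=> q c Bq Bc IHq; rewrite coefficient_brMXaddC !map_polyMXaddC ?linear0 ?d0 //.
rewrite derivD derivM derivC derivX !horner_evalE (brDr brP) // (brMr brP) // IHq (br_horner_base Bp Bc).
rewrite [br _ x](brC brP) x_br_horner //; ring.
Qed.

Lemma coef_coefficient_br (p q : {poly A}) m n : (size p <= m.+1)%N -> (size q <= n.+1)%N ->
  (coefficient_br p q)`_(m + n) = br p`_m q`_n.
Proof.
move=> sp sq; rewrite /coefficient_br.
rewrite (big_ord_widen n.+1 (fun j => map_poly (br^~ q`_j) p * 'X^j)) //.
rewrite big_mkcond coef_sum (bigD1 ord_max) //= big1 ?addr0.
  rewrite addnC; case: ltnP => [_|sq'].
    by rewrite coefMXn ltnNge leq_addr /= addKn coef_map_id0 ?(br0l brP).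
  by rewrite coef0 [q`_n]nth_default // (br0r brP).
move=> -[j j_lt]; rewrite -val_eqE /= => ne_jn; case: ifP => _; last by rewrite coef0.
have lt_jn : (j < n)%N by rewrite ltn_neqAle ne_jn -ltnS.
rewrite coefMXn ltnNge (leq_trans (ltnW lt_jn)) ?leq_addl //=.
rewrite coef_map_id0 ?(br0l brP) // [p`__]nth_default ?(br0l brP) //.
by rewrite (leq_trans sp) // ltn_subRL addnC ltn_add2l.
Qed.

Lemma coefficient_br_in p q : p \is a polyOver B -> q \is a polyOver B ->
  coefficient_br p q \is a polyOver B.
Proof.
move=> /polyOverP Bp /polyOverP Bq; apply: rpred_sum => j _.
rewrite rpredM ?rpredX ?polyOverX //; apply/polyOverP=> i.
by rewrite coef_map_id0 ?(br0l brP) // B_br.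
Qed.

(** Since {x, b} = h(b) x + d(b), the bracket of p(x) and q(x) is the
    coefficientwise bracket plus p'(x) {x, -} applied to the coefficients of q,
    minus the symmetric term. *)
Definition bracket_poly (p q : {poly A}) :=
  coefficient_br p q + p^`() * (h_poly q * 'X + d_poly q)
  - q^`() * (h_poly p * 'X + d_poly p).

Lemma bracket_polyE p q : p \is a polyOver B -> q \is a polyOver B ->
  br p.[x] q.[x] = (bracket_poly p q).[x].
Proof. by move=> Bp Bq; rewrite br_horner_expand // /bracket_poly !horner_evalE. Qed.

Lemma bracket_poly_in p q : p \is a polyOver B -> q \is a polyOver B ->
  bracket_poly p q \is a polyOver B.
Proof.
move=> Bp Bq; have half r s : r \is a polyOver B -> s \is a polyOver B ->
    r^`() * (h_poly s * 'X + d_poly s) \is a polyOver B.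
  move=> Br Bs; rewrite rpredM ?polyOver_deriv // rpredD ?d_polyOver //.
  by rewrite rpredM ?h_polyOver ?polyOverX.
by rewrite rpredB ?rpredD ?coefficient_br_in ?half.
Qed.

(** The terms with d have lower degree in x: only the bracket of the leading
    coefficients and the h-terms reach degree m + n. *)
Lemma coef_bracket_poly p q m n : p \is a polyOver B -> q \is a polyOver B ->
  (size p <= m.+1)%N -> (size q <= n.+1)%N ->
  (bracket_poly p q)`_(m + n) =
    br p`_m q`_n + (h q`_n * p`_m) *+ m - (h p`_m * q`_n) *+ n.
Proof.
have szmap (f : A -> A) (r : {poly A}) k : f 0 = 0 -> (size r <= k.+1)%N ->
    (size (map_poly f r) <= k.+1)%N.
  move=> f0 sr; apply/leq_sizeP=> i ki.
  by rewrite coef_map_id0 // nth_default // (leq_trans sr).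
have half (r s : {poly A}) k l : (size r <= k.+1)%N -> (size s <= l.+1)%N ->
    (r^`() * (h_poly s * 'X + d_poly s))`_(k + l) = (h s`_l * r`_k) *+ k.
  move=> sr ss; rewrite mulrDr coefD mulrCA mulrA coefMX.
  have sr' : (size r^`() <= k.+1)%N.
    by apply/leq_sizeP=> i ki; rewrite coef_deriv nth_default ?mul0rn // (leq_trans sr) // leqW.
  have -> : (r^`() * d_poly s)`_(k + l) = 0.
    rewrite coefM_top ?szmap ?d0 // coef_deriv nth_default ?mul0rn ?mul0r //.
  rewrite addr0; case: k sr sr' => [|k] sr sr'.
    rewrite mulr0n add0n; case: eqP => // _.
    have /size1_polyC -> : (size r <= 1)%N by [].
    by rewrite derivC mulr0 coef0.
  rewrite addSn /= mulrC coefM_top ?szmap ?linear0 //.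
    by rewrite coef_deriv coef_map_id0 ?linear0 // mulrnAl mulrC.
  apply/leq_sizeP=> i ki; rewrite coef_deriv nth_default ?mul0rn //.
  exact: leq_trans sr _.
move=> Bp Bq sp sq; rewrite /bracket_poly !coefB !coefD coef_coefficient_br // half //.
by rewrite [(m + n)%N]addnC half.
Qed.

Lemma R_br f g : f \in R -> g \in R -> br f g \in R.
Proof.
move=> /R_poly[p Bp ->] /R_poly[q Bq ->].
by rewrite bracket_polyE // horner_in // bracket_poly_in.
Qed.

(** * Eigenvectors of the deleting operator and their symbols *)

Lemma natr_sub_eq0 m n : (m%:R - n%:R == 0 :> K) = (m == n).
Proof.
have /pcharf0P Knat := charK0.
wlog le_mn : m n / (m <= n)%N.
  by move=> sym; case: (leqP m n) => [/sym//|/ltnW/sym e]; rewrite -opprB oppr_eq0 e eq_sym.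
by rewrite -opprB oppr_eq0 -natrB // Knat subn_eq0 eqn_leq le_mn.
Qed.

(** The equation E f = m lam f for E = h - x^-1 {x, -}, multiplied by x. *)
Definition hom (m : nat) (f : A) : Prop := br x f = x * (h f - m%:R * L * f).

(** Both sides of the eigenvector equation are polynomials in x over B.
    Comparing coefficients shows that p`_m determines all lower coefficients. *)
Lemma homP m p : p \is a polyOver B ->
  hom m p.[x] <-> d p`_0 = 0 /\
                  forall n, d p`_n.+1 = (lam * (n%:R - m%:R)) *: p`_n.
Proof.
move=> Bp; pose q := 'X * (L *: ('X * p^`() - p *+ m)).
have Bq : q \is a polyOver B.
  rewrite rpredM ?polyOverX // polyOverZ ?B_scal // rpredB ?rpredMn //.
  by rewrite rpredM ?polyOverX ?polyOver_deriv.
have homE : hom m p.[x] <-> d_poly p = q.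
  rewrite /hom x_br_horner // h_horner //.
  have -> : x * ((h_poly p).[x] + L * x * p^`().[x] - m%:R * L * p.[x])
          = (h_poly p).[x] * x + q.[x].
    rewrite /q horner_evalE hornerX hornerZ hornerD hornerN hornerMn !horner_evalE -mulr_natr; ring.
  split=> [/addrI|->//]; exact: horner_inj (d_polyOver Bp) Bq.
have q0 : q`_0 = 0 by rewrite coefXM.
have qS n : q`_n.+1 = (lam * (n%:R - m%:R)) *: p`_n.
  have -> : q`_n.+1 = L * (p`_n *+ n - p`_n *+ m).
    rewrite coefXM /= coefZ coefB coefXM coefMn.
    by case: n => [|n]; rewrite /= ?mulr0n // coef_deriv.
  by rewrite -scaleE -scalerA scalerBl !scaler_nat.
rewrite homE; split=> [epq|[dp0 dpS]].
  by split=> [|n]; rewrite -coef_d epq.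
by apply/polyP=> -[|n]; rewrite coef_d ?q0 ?qS.
Qed.

(** If n is the degree of p, the recursion at n reads 0 = lam (n - m) p`_n. *)
Lemma hom_size m p : p \is a polyOver B -> hom m p.[x] -> p != 0 ->
  size p = m.+1.
Proof.
move=> Bp /(homP _ Bp)[_ dp] p0.
have [n sp] : exists n, size p = n.+1.
  by exists (size p).-1; rewrite prednK // size_poly_gt0.
have := dp n; rewrite [p`_n.+1]nth_default ?sp // d0 => /esym eq0.
have pn0 : p`_n != 0 by have := p0; rewrite -lead_coef_eq0 lead_coefE sp.
case: (eqVneq n m) => [->//|ne_nm]; case/eqP: pn0.
by apply: scale_eq0 eq0; rewrite mulf_neq0 // natr_sub_eq0.
Qed.

Lemma hom_size_le m p : p \is a polyOver B -> hom m p.[x] -> (size p <= m.+1)%N.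
Proof.
by move=> Bp hp; case: (eqVneq p 0) => [->|/(hom_size Bp hp)->]; rewrite ?size_poly0.
Qed.

Definition homR m f := f \in R /\ hom m f.

(** The isomorphism of the m-th eigenspace with B, as a relation: it is partial
    and functional by [symbol_inj], and [symbol_surj] shows that every b in B is
    a symbol for some m. *)
Definition symbol m f b := exists p, [/\ p \is a polyOver B, hom m p.[x], f = p.[x] & p`_m = b].

Lemma hom0 m : hom m 0.
Proof. by rewrite /hom br0r // linear0 mulr0 subrr mulr0. Qed.

Lemma homD m f g : hom m f -> hom m g -> hom m (f + g).
Proof. by rewrite /hom (brDr brP) linearD => -> -> /=; ring. Qed.

Lemma homZ m k f : hom m f -> hom m (k *: f).
Proof. by rewrite /hom (brZr brP) linearZ /= !scaleE => ->; ring. Qed.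

Lemma homM m n f g : hom m f -> hom n g -> hom (m + n) (f * g).
Proof. by rewrite /hom (brMr brP) hM natrD => -> ->; ring. Qed.

Lemma hom1 : hom 0 1.
Proof. by rewrite /hom (br1r brP) h1; ring. Qed.

Lemma hom_x : hom 1 x.
Proof. by rewrite /hom (br_alternating brP) h_x ; ring. Qed.

Lemma hom_xn n : hom n (x ^+ n).
Proof. by elim: n => [|n IHn]; [exact: hom1|rewrite exprS; exact: homM hom_x IHn]. Qed.

(** E is a derivation of the bracket: h is one, x^-1 {x, -} satisfies the same
    identity by Jacobi because the two correction terms that come from x^-1
    cancel. *)
Lemma hom_br m n f g : hom m f -> hom n g -> hom (m + n) (br f g).
Proof.
move=> hf hg; rewrite /hom h_br natrD.
have jac : br x (br f g) = br (br x f) g + br f (br x g).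
  have e : br f (br g x) = - br f (br x g).
    by rewrite [br g x](brC brP) -scaleN1r (brZr brP) scaleN1r.
  have := br_jacobi brP x f g; rewrite e [br g (br x f)](brC brP).
  by move/eqP; rewrite -addrA addr_eq0 opprD !opprK addrC => /eqP.
have brBl a b c : br (a - b) c = br a c - br b c.
  by rewrite (brDl brP) -scaleN1r (brZl brP) scaleN1r.
have brBr a b c : br c (a - b) = br c a - br c b.
  by rewrite (brDr brP) -scaleN1r (brZr brP) scaleN1r.
rewrite jac hf hg (brMl brP) (brMr brP) [br f x](brC brP) hf hg.
rewrite brBl brBr !(brMl brP) !(brMr brP) !br_nat !br_scal.
rewrite ![br _%:R _](brC brP) ![br (scal _) _](brC brP) !br_nat !br_scal; ring.
Qed.

Lemma x_neq0 : x != 0.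
Proof.
apply/eqP=> x0; have : ('X : {poly A}) = 0 by apply: x_free; rewrite ?polyOverX // hornerX.
by move/eqP; rewrite polyX_eq0.
Qed.

Lemma chix_neq0 g : chix g != 0.
Proof.
apply: contraNneq x_neq0 => chi0; apply/eqP; apply: (act_eq0 actP (g := g)).
by rewrite x_act chi0 scale0r.
Qed.

Lemma hom_act m f g : hom m f -> hom m (act g f).
Proof.
move=> hf; rewrite /hom h_act.
have chi0 := chix_neq0 g.
have := congr1 (act g) hf; rewrite (act_br actP) (act_ringM actP) x_act.
rewrite (brZl brP) -scalerAl (actD actP) (actN actP) !(act_ringM actP) act_nat act_scal => e.
by rewrite -[LHS]scale1r -(mulVf chi0) -scalerA e scalerA mulVf // scale1r.
Qed.

Lemma homR_symbol m f : homR m f -> exists2 b, b \in B & symbol m f b.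
Proof.
move=> [/R_poly[p Bp ->] hp]; exists p`_m; last by exists p.
exact/polyOverP.
Qed.

Lemma symbol_homR m f b : symbol m f b -> homR m f.
Proof. by move=> [p [Bp hp -> _]]; split; rewrite ?horner_in. Qed.

Lemma symbol_in m f b : symbol m f b -> b \in B.
Proof. by move=> [p [/polyOverP Bp _ _ <-]]. Qed.

Lemma symbol_eq0 m f : symbol m f 0 -> f = 0.
Proof.
move=> [p [Bp hp -> pm]]; case: (eqVneq p 0) => [->|p0]; first by rewrite horner0.
by have := p0; rewrite -lead_coef_eq0 lead_coefE (hom_size Bp hp p0) pm eqxx.
Qed.

Lemma symbolD m f g a b : symbol m f a -> symbol m g b -> symbol m (f + g) (a + b).
Proof.
move=> [p [Bp hp -> <-]] [q [Bq hq -> <-]]; exists (p + q).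
by rewrite hornerD rpredD // coefD; split=> //; apply: homD.
Qed.

Lemma symbolZ m k f a : symbol m f a -> symbol m (k *: f) (k *: a).
Proof.
move=> [p [Bp hp -> <-]]; exists (k%:A *: p).
by rewrite hornerZ polyOverZ // coefZ !mulr_algl; split=> //; apply: homZ.
Qed.

Lemma symbol_inj m f g b : symbol m f b -> symbol m g b -> f = g.
Proof.
move=> tf tg; have := symbolD tf (symbolZ (-1) tg); rewrite !scaleN1r subrr => /symbol_eq0.
by move/eqP; rewrite subr_eq0 => /eqP.
Qed.

Lemma symbolM m n f g a b : symbol m f a -> symbol n g b -> symbol (m + n) (f * g) (a * b).
Proof.
move=> [p [Bp hp -> <-]] [q [Bq hq -> <-]]; exists (p * q).
rewrite hornerM rpredM // coefM_top ?hom_size_le //; split=> //; exact: homM.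
Qed.

Lemma symbol_x n : symbol n (x ^+ n) 1.
Proof.
exists 'X^n; rewrite rpredX ?polyOverX // hornerXn coefXn eqxx; split=> //.
exact: hom_xn.
Qed.

Lemma symbol_xnM n m f b : symbol m f b -> symbol (n + m) (x ^+ n * f) b.
Proof. by move=> tf; rewrite -[b]mul1r; apply: symbolM tf; apply: symbol_x. Qed.

Lemma symbol1 : symbol 0 1 1. Proof. by have := symbol_x 0. Qed.

Lemma symbol_br m n f g a b : symbol m f a -> symbol n g b ->
  symbol (m + n) (br f g) (br a b + (h b * a) *+ m - (h a * b) *+ n).
Proof.
move=> [p [Bp hp -> <-]] [q [Bq hq -> <-]]; exists (bracket_poly p q).
rewrite bracket_poly_in // -bracket_polyE // coef_bracket_poly ?hom_size_le //; split=> //.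
exact: hom_br.
Qed.

Lemma act_horner g p : p \is a polyOver B ->
  act g p.[x] = (\poly_(i < size p) (chix g ^+ i *: act g p`_i)).[x].
Proof.
move=> Bp; have -> : act g p.[x] = (map_poly (act g) p).[chix g *: x].
  rewrite -x_act; elim/(polyOver_ind (B := B)): p / Bp.
    by rewrite map_poly_0 !horner0 (act0 actP).
  move=> p c _ _ IHp; rewrite map_polyMXaddC ?(act0 actP) // !horner_evalE (actD actP) (act_ringM actP).
  by rewrite IHp.
have sz : (size (map_poly (act g) p) <= size p)%N.
  by apply/leq_sizeP=> i pi; rewrite coef_map_id0 ?(act0 actP) // nth_default ?(act0 actP).
rewrite (horner_coef_wide _ sz) horner_poly; apply: eq_bigr => i _.
by rewrite coef_map_id0 ?(act0 actP) // exprZn -scalerAl -scalerAr.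
Qed.

Lemma symbol_act m f b g : symbol m f b -> symbol m (act g f) (chix g ^+ m *: act g b).
Proof.
move=> [p [Bp hp -> <-]]; exists (\poly_(i < size p) (chix g ^+ i *: act g p`_i)).
rewrite -act_horner //; split=> //.
- apply/polyOverP=> i; rewrite coef_poly; case: ifP; rewrite ?rpred0 // => _.
  by rewrite B_Z // B_act //; apply/polyOverP.
- exact: hom_act.
by rewrite coef_poly; case: ltnP => // /(nth_default 0) ->; rewrite (act0 actP) scaler0.
Qed.

(** Solving the recursion of [homP] downwards from p`_m = b gives
    p`_(m - j) = d^j(b) / (j! (- lam)^j); the condition at 0 is d^(m+1)(b) = 0,
    which local nilpotence provides for large m. Every coefficient lies in any
    d-stable subspace Q that contains b. *)
Lemma hom_lift (Q : A -> Prop) b : (forall a, a \in B -> Q a -> Q (d a)) ->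
  (forall (k : K) a, Q a -> Q (k *: a)) -> b \in B -> Q b ->
  exists m p, [/\ p \is a polyOver B, hom m p.[x], p`_m = b & forall i, Q p`_i].
Proof.
move=> Qd QZ Bb Qb; have [m dm] := d_nil Bb.
pose c j := ((- lam) ^+ j * j`!%:R)^-1.
pose p := \poly_(i < m.+1) (c (m - i)%N *: iter (m - i) d b).
have Qit j : Q (iter j d b) by elim: j => //= j; apply/Qd/iter_d_in.
have Bp : p \is a polyOver B.
  by apply/polyOverP=> i; rewrite coef_poly; case: ifP; rewrite ?rpred0 // B_Z ?iter_d_in.
exists m, p; split=> //.
- apply/homP=> //; split=> [|n].
    by rewrite coef_poly /= subn0 dZ ?iter_d_in // -iterS iterSr /= -iterSr iterS dm d0 scaler0.
  rewrite !coef_poly !ltnS; case: (ltngtP n m) => [lt_nm|lt_mn|->].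
  + rewrite dZ ?iter_d_in //.
    have -> : (m - n)%N = (m - n.+1).+1 by rewrite -subSS subSn.
    have en : n%:R - m%:R = - (m - n.+1).+1%:R :> K.
      by rewrite -opprB -natrB ?(ltnW lt_nm) // -subSS subSn.
    rewrite iterS scalerA en /c; congr (_ *: _); rewrite exprS factS natrM.
    have j0 := natr_neq0 (m - n.+1); have f0 : ((m - n.+1)`!%:R : K) != 0.
      by rewrite -(prednK (fact_gt0 _)) natr_neq0.
    have l0 : (- lam) ^+ (m - n.+1) != 0 by rewrite expf_neq0 // oppr_eq0.
    move: j0 f0 l0; set u := (m - n.+1).+1%:R; set v := _`!%:R; set w := _ ^+ _.
    move=> u0 v0 w0; move: u v w u0 v0 w0 => u v w u0 v0 w0.
    by field; rewrite ?u0 ?v0 ?w0 ?oppr_eq0 ?lam_neq0.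
  + by rewrite d0 scaler0.
  + by rewrite d0 subrr mulr0 scale0r.
- by rewrite coef_poly ltnSn subnn /c expr0 fact0 mulr1 invr1 scale1r.
move=> i; rewrite coef_poly; case: ifP => _; last by rewrite -(scale0r b); apply: QZ.
exact/QZ/Qit.
Qed.

Lemma symbol_surj b : b \in B -> exists m f, symbol m f b.
Proof.
move=> Bb; have [m [p [Bp hp pm _]]] :=
  hom_lift (Q := fun=> True) (fun _ _ _ => I) (fun _ _ _ => I) Bb I.
by exists m, p.[x], p.
Qed.

Lemma h_xn n : h (x ^+ n) = n%:R * L * x ^+ n.
Proof.
elim: n => [|n IHn]; first by rewrite expr0 h1 !mul0r.
by rewrite exprS hM IHn h_x -addn1 natrD; ring.
Qed.

Lemma br_x_xn n : br x (x ^+ n) = 0.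
Proof.
elim: n => [|n IHn]; first by rewrite expr0 (br1r brP).
by rewrite exprS (brMr brP) IHn (br_alternating brP); ring.
Qed.

(** The operator - x (E - m lam), whose kernel is the m-th eigenspace. *)
Definition defect m f := br x f - x * (h f - m%:R * L * f).

Lemma natr_scal m n b :
  ((m%:R - n%:R) * lam) *: b = (m%:R - n%:R) * L * b.
Proof.
by rewrite -scalerA scalerBl !scaler_nat scaleE !mulrBl -!mulrA !mulr_natl.
Qed.

Lemma defect_mono m n b : b \in B ->
  defect m (b * x ^+ n) = d b * x ^+ n + ((m%:R - n%:R) * lam) *: b * x ^+ n.+1.
Proof.
by move=> Bb; rewrite /defect (brMr brP) x_br // br_x_xn hM h_xn natr_scal exprS; ring.
Qed.

Lemma defectD m f g : defect m (f + g) = defect m f + defect m g.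
Proof. by rewrite /defect (brDr brP) linearD /=; ring. Qed.

Lemma defect0 m : defect m 0 = 0.
Proof. by rewrite /defect (br0r brP) linear0; ring. Qed.

Lemma iter_defectD m t f g :
  iter t (defect m) (f + g) = iter t (defect m) f + iter t (defect m) g.
Proof. by elim: t => //= t ->; rewrite defectD. Qed.

Lemma iter_defect0 m t : iter t (defect m) 0 = 0.
Proof. by elim: t => //= t ->; rewrite defect0. Qed.

(** On b x^n with n <= m the operator either lowers the nilpotency order of b
    under d or raises n, and the second term vanishes at n = m; so the sum of
    the nilpotency order and m - n drops at each application. *)
Lemma defect_mono_nil m t : forall e n b, b \in B -> iter e d b = 0 -> (n <= m)%N ->
  (e + (m - n) <= t)%N -> iter t (defect m) (b * x ^+ n) = 0.
Proof.
elim: t => [|t IHt] [|e] n b Bb /= eb le_nm le_t; rewrite ?eb ?mul0r ?iter_defect0 ?defect0 //.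
rewrite -iterS iterSr defect_mono // iter_defectD [X in X + _](IHt e) ?d_in -?iterSr //.
rewrite add0r; move: le_nm le_t; rewrite leq_eqVlt => /orP[/eqP->|lt_nm] le_t.
  by rewrite subrr mul0r scale0r mul0r iter_defect0.
apply: (IHt e.+1); rewrite ?B_Z ?iter_dZ //= ?eb ?scaler0 //.
by rewrite -ltnS (leq_trans _ le_t) // ltn_add2l ltn_sub2l.
Qed.

(** Taking m to be at least the degree of f, all the monomials of f are killed
    by a common power. *)
Lemma defect_nil f : f \in R -> exists m t, iter t (defect m) f = 0.
Proof.
move=> /R_poly[p Bp ->]; exists (size p); set m := size p.
have nil_sum n : (n <= m)%N -> exists T, forall t, (T <= t)%N ->
    iter t (defect m) (\sum_(i < n) p`_i * x ^+ i) = 0; last first.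
  by have [t nil_t] := nil_sum m (leqnn m); exists t; rewrite horner_coef nil_t.
elim: n => [|n IHn] le_nm.
  by exists 0%N => t _; rewrite big_ord0 iter_defect0.
have [T HT] := IHn (ltnW le_nm).
have Bn : p`_n \in B by apply/polyOverP.
have [e en] := d_nil Bn.
exists (maxn T (e + (m - n))) => t; rewrite geq_max => /andP[le_T le_e].
by rewrite big_ord_recr /= iter_defectD HT // add0r (defect_mono_nil Bn en) // ltnW.
Qed.

Section Ideal.
Variable P : A -> Prop.
Hypothesis SP : stable_ideal br act R P.

Lemma stable_lie f : P f -> P (h f).
Proof.
apply: h_stable => [k a b Pa Pb|g a]; last exact: (stable_act SP).
by apply: (stableD SP) => //; apply: (stableZ R_alg SP).
Qed.

Lemma stable_defect m f : P f -> P (defect m f).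
Proof.
move=> Pf; have Pmul := stableM SP; apply: (stableD SP); first exact: (stable_br SP).
apply: (stableN R_alg SP); apply: (Pmul) => //; apply: (stableD SP); first exact: stable_lie.
apply: (stableN R_alg SP); apply: (Pmul) => //.
by rewrite rpredM ?rpred_nat //; apply: R_alg.
Qed.

(** The last nonzero iterate of the nilpotent operator on a nonzero element of P
    lies in P and in the kernel of the operator. *)
Lemma stable_has_hom : (exists2 f, P f & f != 0) ->
  exists m f b, [/\ P f, symbol m f b & b != 0].
Proof.
move=> [f Pf f0]; have [m [t ft]] := defect_nil (stable_sub SP Pf); exists m.
elim: t f Pf f0 ft => [|t IHt] f Pf f0 ft; first by rewrite /= in ft; rewrite ft eqxx in f0.
case: (eqVneq (defect m f) 0) => [Wf0|]; last first.
  by move/IHt; apply; [exact: stable_defect|rewrite -iterSr].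
have hf : hom m f by apply/eqP; rewrite -subr_eq0; apply/eqP.
have [b _ tb] := homR_symbol (conj (stable_sub SP Pf) hf).
exists f, b; split=> //; apply: contraNneq f0 => b0; rewrite b0 in tb.
by rewrite (symbol_eq0 tb).
Qed.

Definition symbol_ideal b := exists m f, P f /\ symbol m f b.

(** By [symbol_br] the bracket of symbols differs from the symbol of the bracket
    by multiples of a h(b) and h(a) b; these are again symbols, because stability
    under the group gives stability under h. *)
Lemma symbol_idealP : stable_ideal br act B symbol_ideal.
Proof.
have zero : symbol_ideal 0.
  exists 0%N, 0; split; first exact: (stable0 SP).
  by exists 0; rewrite rpred0 horner0 coef0; split=> //; apply: hom0.
have add a b : symbol_ideal a -> symbol_ideal b -> symbol_ideal (a + b).
  move=> [m [f [Pf tf]]] [n [g [Pg tg]]].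
  exists (n + m)%N, (x ^+ n * f + x ^+ m * g); split.
    by apply: (stableD SP); apply: (stableM SP) => //; rewrite rpredX.
  by apply: symbolD; [|rewrite addnC]; apply: symbol_xnM.
have mul a b : a \in B -> symbol_ideal b -> symbol_ideal (a * b).
  move=> Ba [m [f [Pf tf]]]; have [n [g tg]] := symbol_surj Ba.
  exists (n + m)%N, (g * f); split; last exact: symbolM.
  by apply: (stableM SP) => //; have [] := symbol_homR tg.
have scl (k : K) b : symbol_ideal b -> symbol_ideal (k *: b).
  by move=> Tb; rewrite scaleE; apply: mul => //; apply: B_scal.
have opp b : symbol_ideal b -> symbol_ideal (- b) by rewrite -scaleN1r; apply: scl.
have tact g a : symbol_ideal a -> symbol_ideal (act g a).
  move=> [m [f [Pf tf]]].
  have := scl (chix g ^+ m)^-1 (chix g ^+ m *: act g a).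
  rewrite scalerA mulVf ?scale1r ?expf_neq0 ?chix_neq0 //; apply.
  by exists m, (act g f); split; [apply: (stable_act SP)|apply: symbol_act].
have th a : symbol_ideal a -> symbol_ideal (h a).
  by apply: h_stable => // k b c Tb Tc; apply: add => //; apply: scl.
split=> //.
  by move=> b [m [f [_ /symbol_in]]].
move=> a b Ba Tb; have Bb : b \in B by case: Tb => m [f [_ /symbol_in]].
have [l [w tw]] := symbol_surj Ba; have [m [f [Pf tf]]] := Tb.
have [Rw _] := symbol_homR tw.
have := symbol_br tw tf; set r := br a b + _ - _ => tr.
have -> : br a b = r + - (l%:R * (a * h b)) + m%:R * (h a * b).
  by rewrite /r -[_ *+ l]mulr_natl -[_ *+ m]mulr_natl; ring.
have Tmul k c : symbol_ideal c -> symbol_ideal (k%:R * c).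
  by apply: mul; rewrite rpred_nat.
apply: (add); last by apply/Tmul/mul; rewrite ?h_in.
apply: (add); last by apply/opp/Tmul/mul => //; apply: th.
by exists (l + m)%N, (br w f); split=> //; apply: (stable_br SP).
Qed.

End Ideal.

(** * Lifting Poisson-primes from B to R *)
Lemma mulx_horner p : x * p.[x] = ('X * p).[x]. Proof. by rewrite hornerM hornerX. Qed.

Lemma polyOver_mulX p : p \is a polyOver B -> 'X * p \is a polyOver B.
Proof. by move=> Bp; rewrite rpredM ?polyOverX. Qed.

Lemma mulX_inj : injective (fun p : {poly A} => 'X * p).
Proof. by move=> p q /polyP e; apply/polyP=> i; have := e i.+1; rewrite !coefXM. Qed.

Lemma x_cancel f g : f \in R -> g \in R -> x * f = x * g -> f = g.
Proof.
move=> /R_poly[p Bp ->] /R_poly[q Bq ->]; rewrite !mulx_horner => e.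
by congr (_.[x]); apply/mulX_inj/horner_inj; rewrite ?polyOver_mulX.
Qed.

Lemma divides_x p : p \is a polyOver B -> p`_0 = 0 -> divides R x p.[x].
Proof.
move=> Bp p0; exists (drop_poly 1 p).[x].
  by apply/horner_in/polyOverP=> i; rewrite coef_drop_poly; apply/polyOverP.
rewrite mulrC mulx_horner; congr (_.[x]); apply/polyP=> -[|i]; rewrite coefXM //=.
by rewrite coef_drop_poly addn1.
Qed.

Lemma x_prime f g : f \in R -> g \in R ->
  divides R x (f * g) -> divides R x f \/ divides R x g.
Proof.
move=> /R_poly[p Bp ->] /R_poly[q Bq ->] [_ /R_poly[r Br ->]].
rewrite mulrC [RHS]mulrC mulx_horner -hornerM => /horner_inj e.
have := congr1 (fun r : {poly A} => r`_0) (e (rpredM Bq Bp) (polyOver_mulX Br)).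
rewrite coefXM -[RHS]/0 coefM big_ord_recl big_ord0 addr0 /= subn0 => /A_dom[q0|p0].
  by right; apply: divides_x.
by left; apply: divides_x.
Qed.

(** x is an eigenvector of E for the eigenvalue lam, so dividing by x lowers the
    degree by one. *)
Lemma hom_div_x m f : f \in R -> hom m.+1 (x * f) -> hom m f.
Proof.
move=> Rf; rewrite /hom (brMr brP) (br_alternating brP) hM h_x => e.
apply: x_cancel; first exact: R_br.
  rewrite rpredM // rpredB ?rpredM ?rpred_nat ?R_alg //.
  have [p Bp ->] := R_poly Rf; rewrite h_horner //.
  rewrite rpredD ?horner_in ?h_polyOver // !rpredM ?horner_in ?polyOver_deriv //.
  exact: R_alg.
transitivity (0 * f + x * br x f); first by ring.
by rewrite e -addn1 natrD; ring.
Qed.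

Lemma symbol_div_x m f b : f \in R -> symbol m.+1 (x * f) b -> symbol m f b.
Proof.
move=> Rf [p [Bp hp ep pm]]; have [q Bq eq] := R_poly Rf.
exists q; split=> //; first by rewrite -eq; apply: hom_div_x => //; rewrite ep.
have e : 'X * q = p by apply: horner_inj; rewrite ?polyOver_mulX // -mulx_horner -eq.
by rewrite -pm -e coefXM.
Qed.

Lemma symbol_x0 f b : f \in R -> symbol 0 (x * f) b -> b = 0.
Proof.
move=> /R_poly[q Bq ->] [p [Bp _ ep <-]].
have -> : p = 'X * q by apply: horner_inj; rewrite ?polyOver_mulX // -mulx_horner -ep.
by rewrite coefXM.
Qed.

(** Dividing a lift by x lowers its degree m by one and keeps its symbol. This
    stops at m = 0 at the latest, where a lift has degree 0 in x and is therefore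
    not a multiple of x. *)
Lemma symbol_surj_min b : b \in B -> b != 0 -> exists m f, symbol m f b /\ ~ divides R x f.
Proof.
move=> Bb b0; have [m [f]] := symbol_surj Bb.
elim: m f => [|m IHm] f tf.
  exists 0%N, f; split=> // -[g Rg ef]; rewrite ef mulrC in tf.
  by case/eqP: b0; apply: symbol_x0 tf.
have [[g Rg ef]|] := classic (divides R x f); last by exists m.+1, f.
by rewrite ef mulrC in tf; apply: IHm (symbol_div_x Rg tf).
Qed.

(** Sums of eigenvectors of degrees n - 1, ..., 1, 0, listed from the top. *)
Inductive hom_sum : nat -> A -> Prop :=
| hom_sum_nil : hom_sum 0 0
| hom_sum_cons n u f : homR n u -> hom_sum n f -> hom_sum n.+1 (u + f).

Lemma homR0 n : homR n 0. Proof. by split; [exact: rpred0|exact: hom0]. Qed.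

Lemma homRD n u v : homR n u -> homR n v -> homR n (u + v).
Proof. by move=> [Ru hu] [Rv hv]; split; [exact: rpredD|exact: homD]. Qed.

Lemma homR_x n u : homR n u -> homR n.+1 (x * u).
Proof. by move=> [Ru hu]; split; [exact: rpredM|exact: homM hom_x hu]. Qed.

Lemma hom_sum0 n : hom_sum n 0.
Proof.
elim: n => [|n IHn]; first exact: hom_sum_nil.
by rewrite -[0]addr0; apply: hom_sum_cons => //; apply: homR0.
Qed.

Lemma hom_sum_S n f : hom_sum n f -> hom_sum n.+1 f.
Proof. by move=> Hf; rewrite -[f]add0r; apply: hom_sum_cons => //; apply: homR0. Qed.

Lemma hom_sum_le n m f : (n <= m)%N -> hom_sum n f -> hom_sum m f.
Proof.
by move=> /subnK<-; elim: (m - n)%N => //= k IHk /IHk; rewrite addSn; apply: hom_sum_S.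
Qed.

Lemma hom_sumD n f g : hom_sum n f -> hom_sum n g -> hom_sum n (f + g).
Proof.
move=> Hf; elim: Hf g => [g|{}n u {}f Hu _ IHf g' Hg'] //; first by rewrite add0r.
inversion Hg' as [|? v g Hv Hg]; subst.
have -> : u + f + (v + g) = (u + v) + (f + g) by ring.
by apply: hom_sum_cons; [exact: homRD|exact: IHf].
Qed.

Lemma hom_sumZ n k f : hom_sum n f -> hom_sum n (k *: f).
Proof.
elim=> [|{}n u {}f [Ru hu] _ IHf]; first by rewrite scaler0; apply: hom_sum_nil.
by rewrite scalerDr; apply: hom_sum_cons => //; split; [exact: R_Z|exact: homZ].
Qed.

Lemma hom_sum_x n f : hom_sum n f -> hom_sum n.+1 (x * f).
Proof.
elim=> [|{}n u {}f Hu _ IHf]; first by rewrite mulr0; apply: hom_sum0.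
by rewrite mulrDr; apply: hom_sum_cons => //; apply: homR_x.
Qed.

Lemma hom_sum_xn k n f : hom_sum n f -> hom_sum (k + n) (x ^+ k * f).
Proof.
move=> Hf; elim: k => [|k IHk]; first by rewrite mul1r.
by rewrite exprS -mulrA; apply: hom_sum_x.
Qed.

Lemma homR_hom_sum n u : homR n u -> hom_sum n.+1 u.
Proof. by move=> Hu; rewrite -[u]addr0; apply: hom_sum_cons => //; apply: hom_sum0. Qed.

(** Membership in the sum of the eigenspaces of R[x^-1], with denominators
    cleared. *)
Definition decomposable f := exists k n, hom_sum n (x ^+ k * f).

Lemma decomposableD f g : decomposable f -> decomposable g -> decomposable (f + g).
Proof.
move=> [k [n Hf]] [l [m Hg]]; exists (l + k)%N, (maxn (l + n) (k + m)).
rewrite mulrDr; apply: hom_sumD; [rewrite exprD|rewrite [(l + k)%N]addnC exprD]; rewrite -mulrA.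
  by apply: hom_sum_le (hom_sum_xn l Hf); apply: leq_maxl.
by apply: hom_sum_le (hom_sum_xn k Hg); apply: leq_maxr.
Qed.

Lemma decomposableZ k f : decomposable f -> decomposable (k *: f).
Proof. by move=> [l [n Hf]]; exists l, n; rewrite -scalerAr; apply: hom_sumZ. Qed.

Lemma decomposable_xn n f : decomposable f -> decomposable (x ^+ n * f).
Proof. by move=> [k [m /(hom_sum_xn n)Hf]]; exists k, (n + m)%N; rewrite mulrCA. Qed.

Lemma decomposable_xnV n f : decomposable (x ^+ n * f) -> decomposable f.
Proof. by move=> [k [m Hf]]; exists (k + n)%N, m; rewrite exprD -mulrA. Qed.

(** If p(x) is the eigenvector with symbol b, then b x^m - p(x) has coefficients
    of smaller nilpotency order than b. *)
Lemma decomposable_base e : forall b, b \in B -> iter e d b = 0 -> decomposable b.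
Proof.
elim: e => [|e IHe] b Bb eb.
  by exists 0%N, 0%N; rewrite /= in eb; rewrite eb mulr0; apply: hom_sum_nil.
have [m [f [p [Bp hp _ pm]]]] := symbol_surj Bb.
have [_ dp] := (homP m Bp).1 hp.
have pB i : p`_i \in B by apply/polyOverP.
have low j i : (i + j = m)%N -> iter e.+1 d p`_i = 0 /\ ((i < m)%N -> iter e d p`_i = 0).
  elim: j i => [|j IHj] i eij.
    by move: eij; rewrite addn0 => ->; rewrite pm eb ltnn.
  have /IHj[] : (i.+1 + j = m)%N by rewrite addSnnS.
  have lt_im : (i < m)%N by rewrite -eij -addSnnS leq_addr.
  rewrite iterSr dp iter_dZ // => di _.
  suff di0 : iter e d p`_i = 0 by rewrite iterS di0 d0.
  apply: scale_eq0 di; rewrite mulf_neq0 // natr_sub_eq0.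
  by rewrite neq_ltn lt_im.
apply: (@decomposable_xnV m).
have -> : x ^+ m * b = p.[x] + - \sum_(i < m) p`_i * x ^+ i.
  rewrite (horner_coef_wide _ (hom_size_le Bp hp)) big_ord_recr /= pm; ring.
apply: decomposableD.
  by exists 0%N, m.+1; rewrite mul1r; apply: homR_hom_sum; split; rewrite ?horner_in.
rewrite -scaleN1r; apply: decomposableZ; elim/big_ind: _ => [|? ?|i _].
- by exists 0%N, 0%N; rewrite mulr0; apply: hom_sum_nil.
- exact: decomposableD.
rewrite mulrC; apply: decomposable_xn; apply: IHe => //.
have [_] := low (m - i)%N i (subnKC (ltnW (ltn_ord i))); exact.
Qed.

(** R[x^-1] is the sum of the eigenspaces of E. *)
Lemma decomposableP f : f \in R -> decomposable f.
Proof.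
move=> /R_poly[p Bp ->]; rewrite horner_coef; elim/big_ind: _ => [|? ?|i _].
- by exists 0%N, 0%N; rewrite mulr0; apply: hom_sum_nil.
- exact: decomposableD.
have Bi : p`_i \in B by apply/polyOverP.
by rewrite mulrC; apply: decomposable_xn; have [e /(decomposable_base Bi)] := d_nil Bi.
Qed.

Lemma lie_eigen c chi : (forall g, act g c = chi g *: c) -> exists k, h c = k *: c.
Proof.
move=> actc; apply: (h_stable (V := fun f => exists k, f = k *: c)).
- by move=> k f g [u ->] [v ->]; exists (k * u + v); rewrite scalerDl scalerA.
- by move=> g _ [u ->]; exists (u * chi g); rewrite (actZ actP) actc scalerA.
by exists 1; rewrite scale1r.
Qed.

(** Throughout the section a is Poisson-prime in B, and c is an eigenvector of E
    with symbol a that x does not divide. The last condition makes divisibility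
    by c in R equivalent to divisibility in R[x^-1] ([div_cancel_xn]), where it
    is read off on symbols ([divides_symbol]). *)
Section LiftPrime.
Variables (a : A) (m : nat) (c : A).
Hypotheses (a_prime : prime_eigen br act B a) (tc : symbol m c a).
Hypothesis ndiv_xc : ~ divides R x c.

Let Rc : c \in R. Proof. by have [] := symbol_homR tc. Qed.

Lemma div_cancel_xn n f : f \in R -> divides R c (x ^+ n * f) -> divides R c f.
Proof.
move=> Rf; elim: n => [|n IHn]; first by rewrite mul1r.
rewrite exprS -mulrA => -[s Rs es]; apply: IHn.
have /(x_prime Rs Rc)[] // : divides R x (s * c).
  by exists (x ^+ n * f); rewrite ?rpredM ?rpredX // -es mulrC.
move=> [t Rt et]; exists t => //; apply: x_cancel; rewrite ?rpredM ?rpredX //.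
by rewrite es et; ring.
Qed.

Lemma divides_symbol n f b : symbol n f b -> divides B a b -> divides R c f.
Proof.
move=> tf [b' Bb' eb]; have [l [w tw]] := symbol_surj Bb'; have [Rw _] := symbol_homR tw.
have [Rf _] := symbol_homR tf; apply: (@div_cancel_xn (l + m)) => //.
have e : x ^+ (l + m) * f = x ^+ n * (w * c).
  have t1 := symbol_xnM (l + m) tf; have t2 := symbol_xnM n (symbolM tw tc).
  by rewrite addnC -eb in t2; apply: symbol_inj t1 t2.
by exists (x ^+ n * w); rewrite ?rpredM ?rpredX // e mulrA.
Qed.

Lemma lift_act : exists chi : G -> K, forall g, act g c = chi g *: c.
Proof.
have [chi acta] := normal_act (prime_normal a_prime).
exists (fun g => chix g ^+ m * chi g) => g.
have := symbol_act g tc; rewrite acta scalerA => t1.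
exact: symbol_inj t1 (symbolZ _ tc).
Qed.

Lemma div_br_x : divides R c (br c x).
Proof.
have [_ hc] := symbol_homR tc; have [_ /lie_eigen[k ek]] := lift_act.
rewrite (brC brP) hc ek scaleE; exists (- (x * (scal k - m%:R * L))); last by ring.
by rewrite rpredN rpredM // rpredB ?rpredM ?rpred_nat ?R_alg.
Qed.

Lemma div_br_xn n : divides R c (br c (x ^+ n)).
Proof.
elim: n => [|n IHn]; first by rewrite expr0 (br1r brP); apply: divides0.
rewrite exprS (brMr brP); apply: dividesD; last exact: dividesMl.
by rewrite mulrC; apply: dividesMl; rewrite ?rpredX //; apply: div_br_x.
Qed.

(** The symbol of {c, f} is {a, b} plus multiples of a h(b) and h(a) b, all of
    which a divides. *)
Lemma div_br_homR n f : homR n f -> divides R c (br c f).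
Proof.
move=> /homR_symbol[b Bb tf]; apply: (divides_symbol (symbol_br tc tf)).
have [u Bu eu] := normal_br (prime_normal a_prime) Bb.
have [_ /lie_eigen[k ek]] := normal_act (prime_normal a_prime).
exists (u + h b *+ m - (k *: b) *+ n).
  by rewrite rpredB ?rpredD ?rpredMn ?B_Z ?h_in.
by rewrite eu ek !mulrBl !mulrDl !mulrnAl -!scalerAl [b * a]mulrC.
Qed.

Lemma lift_normal : normal_eigen br act R c.
Proof.
split=> //; last exact: lift_act.
move=> f Rf; have [k [n Hf]] := decomposableP Rf.
have : divides R c (br c (x ^+ k * f)).
  elim: Hf => [|{}n u g Hu _ IHg]; first by rewrite (br0r brP); apply: divides0.
  by rewrite (brDr brP); apply: dividesD => //; apply: div_br_homR Hu.
rewrite (brMr brP) => dv; apply: (@div_cancel_xn k); first exact: R_br.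
have -> : x ^+ k * br c f = (br c (x ^+ k) * f + x ^+ k * br c f) - f * br c (x ^+ k) by ring.
by apply: dividesD dv _; apply/dividesN/dividesMl => //; apply: div_br_xn.
Qed.

Lemma hom_sum_poly n f : hom_sum n f ->
  exists p, [/\ p \is a polyOver B, f = p.[x] & (size p <= n)%N].
Proof.
elim=> [|{}n u g [Ru hu] _ [q [Bq -> sq]]]; first by exists 0; rewrite rpred0 horner0 size_poly0.
have [p Bp ep] := R_poly Ru; exists (p + q); rewrite rpredD // hornerD ep; split=> //.
rewrite (leq_trans (size_polyD _ _)) // geq_max (leqW sq) hom_size_le //.
by rewrite -ep.
Qed.

(** In a sum of eigenvectors the terms whose symbol is a multiple of a are
    multiples of c and can be dropped. If any term remains, the leading
    coefficient of the rest is the symbol of its top term. *)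
Lemma lead_reduction n f : hom_sum n f ->
  (exists k, divides R c (x ^+ k * f)) \/
  exists k p, [/\ p \is a polyOver B, ~ divides B a (lead_coef p)
                & divides R c (x ^+ k * f - p.[x])].
Proof.
elim=> [|{}n u g Hu Hg IHg]; first by left; exists 0%N; rewrite mulr0; apply: divides0.
have [b Bb tu] := homR_symbol Hu; have [Ru _] := Hu.
have [ab|nab] := classic (divides B a b).
  have cu k : divides R c (x ^+ k * u) by apply: dividesMl (divides_symbol tu ab); rewrite rpredX.
  case: IHg => [[k cg]|[k [p [Bp np cg]]]].
    by left; exists k; rewrite mulrDr; apply: dividesD.
  right; exists k, p; split=> //.
  by rewrite mulrDr -addrA; apply: dividesD.
right; exists 0%N; have [p [Bp hp eu pb]] := tu; have [q [Bq eg sq]] := hom_sum_poly Hg.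
exists (p + q); rewrite rpredD // mul1r hornerD eu eg subrr; split=> //; last exact: divides0.
have p0 : p != 0.
  apply/eqP=> p0; apply: nab; rewrite -pb p0 coef0; exists 0; rewrite ?rpred0 ?mul0r //.
have sp := hom_size Bp hp p0.
by rewrite lead_coefDl ?sp ?ltnS // lead_coefE sp pb.
Qed.

Lemma lead_coef_in p : p \is a polyOver B -> lead_coef p \in B.
Proof. by move/polyOverP=> Bp; rewrite lead_coefE. Qed.

Lemma lead_coef_multiple p : p \is a polyOver B -> divides R c p.[x] ->
  divides B a (lead_coef p).
Proof.
move=> Bp [_ /R_poly[s Bs ->]]; have [q [Bq hq -> qa]] := tc.
rewrite -hornerM => /horner_inj -> //; last exact: rpredM.
have q0 : q != 0.
  by apply: contraTneq (prime_neq0 a_prime) => q0; rewrite -qa q0 coef0 eqxx.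
case: (eqVneq s 0) => [->|s0].
  by rewrite mul0r lead_coef0; exists 0; rewrite ?rpred0 ?mul0r.
exists (lead_coef s); rewrite ?lead_coef_in // lead_coef_mul //.
by rewrite (lead_coefE q) (hom_size Bq hq q0) qa.
Qed.

(** If neither f nor g is a multiple of c, replace them by p(x) and q(x) whose
    leading coefficients a does not divide; since a is prime it does not divide
    their product, which is the leading coefficient of p(x) q(x), whereas it
    divides the leading coefficient of every multiple of c. *)
Lemma lift_prime : prime_eigen br act R c.
Proof.
split; first exact: lift_normal.
- apply/eqP=> c0; have := prime_neq0 a_prime; case/eqP.
  have [p [Bp hp ep <-]] := tc; rewrite (_ : p = 0) ?coef0 //.
  by apply: x_free; rewrite -?ep.
- move=> c1; apply: (prime_proper a_prime); rewrite -(lead_coef1 A).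
  by apply: lead_coef_multiple; rewrite ?rpred1 // hornerC.
move=> f g Rf Rg cfg.
have [k [n Hf]] := decomposableP Rf; have [l [n' Hg]] := decomposableP Rg.
case: (lead_reduction Hf) => [[k' cf]|[k' [p [Bp np cf]]]].
  by left; apply: (@div_cancel_xn (k' + k)); rewrite // exprD -mulrA.
case: (lead_reduction Hg) => [[l' cg]|[l' [q [Bq nq cg]]]].
  by right; apply: (@div_cancel_xn (l' + l)); rewrite // exprD -mulrA.
have nz (r : {poly A}) : ~ divides B a (lead_coef r) -> r != 0.
  move=> nr; apply/eqP=> r0; apply: nr; rewrite r0 lead_coef0.
  by exists 0; rewrite ?rpred0 ?mul0r.
have cpq : divides R c (p * q).[x].
  have -> : (p * q).[x] = (x ^+ (k' + k) * x ^+ (l' + l)) * (f * g)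
      - (x ^+ l' * (x ^+ l * g)) * (x ^+ k' * (x ^+ k * f) - p.[x])
      - p.[x] * (x ^+ l' * (x ^+ l * g) - q.[x]).
    by rewrite hornerM !exprD; ring.
  by apply: dividesD; [apply: dividesD|]; [|apply: dividesN|apply: dividesN]; apply: dividesMl;
    rewrite ?rpredM ?rpredX ?horner_in.
have := lead_coef_multiple (rpredM Bp Bq) cpq.
rewrite lead_coef_mul ?nz // => /(prime_mul a_prime (lead_coef_in Bp) (lead_coef_in Bq)).
by case.
Qed.

End LiftPrime.

Lemma lift_prime_product a : prime_product br act B a ->
  exists m c, symbol m c a /\ prime_product br act R c.
Proof.
move=> [s s_prime ->]; elim: s s_prime => [|b s IHs] s_prime.
  exists 0%N, 1; rewrite big_nil; split; first exact: symbol1.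
  by exists [::]; rewrite ?big_nil.
have [m [c [tc [t t_prime ec]]]] :
    exists m c, symbol m c (\prod_(c <- s) c) /\ prime_product br act R c.
  by apply: IHs => z sz; apply: s_prime; rewrite inE sz orbT.
have b_prime : prime_eigen br act B b by apply: s_prime; rewrite mem_head.
have [n [e [te ne]]] := symbol_surj_min (normal_in (prime_normal b_prime)) (prime_neq0 b_prime).
exists (n + m)%N, (e * c); rewrite big_cons; split; first exact: symbolM.
exists (e :: t); last by rewrite big_cons ec.
move=> z; rewrite inE => /orP[/eqP->|/t_prime//].
exact: lift_prime b_prime te ne.
Qed.

Lemma prime_x : (forall b, b \in B -> d b = 0) -> prime_eigen br act R x.
Proof.
move=> dB; split.
- split=> //; last by exists chix.
  move=> _ /R_poly[p Bp ->]; rewrite x_br_horner //.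
  exists (h_poly p).[x]; first by rewrite horner_in ?h_polyOver.
  rewrite (_ : d_poly p = 0) ?horner0 ?addr0 //.
  by apply/polyP=> i; rewrite coef_d coef0 dB //; apply/polyOverP.
- exact: x_neq0.
- move=> [_ /R_poly[p Bp ->]] e.
  have : 1 = 'X * p.
    by apply: horner_inj; rewrite ?rpred1 ?polyOver_mulX // -mulx_horner hornerC mulrC.
  by move/(congr1 (fun r : {poly A} => r`_0)); rewrite coefXM coef1 /= => /eqP; rewrite oner_eq0.
by move=> f g Rf Rg; apply: x_prime.
Qed.

(** With e = d(b), the bracket of x^(n+1) e^k with b is
    (n+1) x^n e^(k+1) modulo x^(n+1) e^k and x^(n+1) e^(k-1) {e, b}; multiplying
    by e puts both error terms in P. So x^(n+1) e^k in P implies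
    x^n e^(k+2) in P. *)
Lemma power_in_ideal P b n : stable_ideal br act R P -> b \in B ->
  P (x ^+ n) -> exists k, P (d b ^+ k).
Proof.
move=> SP Bb; rewrite -[x ^+ n]mulr1 -(expr0 (d b)); move: 0%N => k.
have Re : d b \in R by rewrite sBR ?d_in.
have Rb : b \in R by exact: sBR.
have Rh : h b \in R by rewrite sBR ?h_in.
elim: n k => [|n IHn] k Pn; first by exists k; rewrite mul1r in Pn.
apply: (IHn k.+2).
have brX (y : A) j : br (y ^+ j.+1) b = j.+1%:R * y ^+ j * br y b.
  elim: j => [|j IHj]; first by rewrite mulr1 mul1r.
  by rewrite exprS (brMl brP) IHj -[in RHS]addn1 natrD !exprS; ring.
suff P2 : P (n.+1%:R *: (x ^+ n * d b ^+ k.+2)).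
  rewrite -[X in P X]scale1r -(mulVf (natr_neq0 n)) -scalerA.
  by apply: (stableZ R_alg SP); apply: P2.
have -> : n.+1%:R *: (x ^+ n * d b ^+ k.+2) =
    d b * br (x ^+ n.+1 * d b ^+ k) b
    + (- (n.+1%:R * h b * d b) - k%:R * br (d b) b) * (x ^+ n.+1 * d b ^+ k).
  rewrite scaler_nat -mulr_natl (brMl brP) brX x_br //.
  case: k {Pn} => [|k]; last by rewrite brX !exprS; ring.
  by rewrite expr0 (brC brP 1) (br1r brP) !exprS; ring.
have Pmul := stableM SP; apply: (stableD SP); apply: (Pmul) => //.
  exact: (stable_brl brP R_alg SP).
by rewrite rpredB ?rpredN ?rpredM ?rpred_nat // R_br.
Qed.

(** * The inductive step *)
Theorem ore_step : meets_prime_products br act B -> meets_prime_products br act R.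
Proof.
move=> IH P SP Pn0; have SP0 := symbol_idealP SP.
have [|a [n [f [Pf tf]]] a_prod] := IH _ SP0.
  by have [m [f [b [Pf tf b0]]]] := stable_has_hom SP Pn0; exists b => //; exists m, f.
have [m [c [tc c_prod]]] := lift_prime_product a_prod.
have Pc : P (x ^+ n * c).
  have t1 := symbol_xnM m tf; rewrite addnC in t1.
  rewrite (symbol_inj (symbol_xnM n tc) t1); apply: (stableM SP) => //.
  by rewrite rpredX.
(* With d = 0 the power of x is itself a product of Poisson-primes. *)
have [dB|ndB] := classic (forall b, b \in B -> d b = 0).
  exists (x ^+ n * c) => //; apply: prime_productM => //.
  exists (nseq n x); last by rewrite big_nseq -Monoid.iteropE.
  by move=> y /nseqP[-> _]; apply: prime_x.
have [b Bb db0] : exists2 b, b \in B & d b != 0.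
  apply: NNPP => nb; apply: ndB => b Bb; apply/eqP/negPn/negP => db0.
  by apply: nb; exists b.
have c_norm : normal_eigen br act R c.
  by have [s s_prime ->] := c_prod; apply: normal_eigen_prod.
have SJ := stable_colon brP actP R_alg R_act R_br SP c_norm.
set J := (fun _ => _) in SJ.
have Jx : J (x ^+ n) by split; rewrite ?rpredX.
have [k Jk] := power_in_ideal SJ Bb Jx.
pose Q q := q \in B /\ J q.
have SQ : stable_ideal br act B Q.
  split=> [q []//||p q [Bp Jp] [Bq Jq]|p q Bp [Bq Jq]|p q Bp [Bq Jq]|g q [Bq Jq]].
  - by split; [exact: rpred0|exact: (stable0 SJ)].
  - by split; [exact: rpredD|exact: (stableD SJ)].
  - by split; [exact: rpredM|apply: (stableM SJ) => //; exact: sBR].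
  - by split; [exact: B_br|apply: (stable_br SJ) => //; exact: sBR].
  - by split; [exact: B_act|exact: (stable_act SJ)].
have [|a' Qa' a'_prod] := IH _ SQ.
  exists (d b ^+ k); first by split; rewrite ?rpredX ?d_in.
  elim: k {Jk} => [|k IHk]; first exact: oner_neq0.
  by rewrite exprS; apply/eqP=> /A_dom[/eqP|/eqP]; apply/negP.
have [m' [c' [tc' c'_prod]]] := lift_prime_product a'_prod.
(* The relation d q = {x, q} - x h(q) makes J and B meet in a d-stable set. *)
have Qd q : q \in B -> Q q -> Q (d q).
  move=> Bq [_ Jq]; split; first exact: d_in.
  have -> : d q = br x q + - (x * h q) by rewrite x_br //; ring.
  apply: (stableD SJ); first exact: (stable_br SJ).
  by apply: (stableN R_alg SJ); apply: (stableM SJ) => //; apply: stable_lie.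
have QZ (z : K) q : Q q -> Q (z *: q).
  by move=> [Bq Jq]; split; [exact: B_Z|exact: (stableZ R_alg SJ)].
have [l [p [Bp hp pa Qp]]] := hom_lift Qd QZ (symbol_in tc') Qa'.
have [q [Bq hq ec' qa]] := tc'.
(* Two lifts of a' agree up to powers of x, so c' has the coefficients of p up
   to a shift. *)
have epq : 'X^m' * p = 'X^l * q.
  apply: horner_inj; rewrite ?rpredM ?rpredX ?polyOverX // !hornerM !hornerXn -ec'.
  have tp : symbol l p.[x] a' by exists p.
  have t1 := symbol_xnM m' tp; rewrite addnC in t1.
  exact: symbol_inj t1 (symbol_xnM l tc').
have Qq i : Q q`_i.
  have := congr1 (fun r : {poly A} => r`_(l + i)) epq.
  rewrite [in RHS]coefXnM ltnNge leq_addr /= addKn => <-; rewrite coefXnM.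
  by case: ifP => _ //; apply: (stable0 SQ).
have Jc' : J c'.
  rewrite ec' horner_coef; elim/big_ind: _ => [|? ?|i _].
  - exact: (stable0 SJ).
  - exact: (stableD SJ).
  by rewrite mulrC; apply: (stableM SJ); rewrite ?rpredX //; case: (Qq i).
by exists (c' * c); [case: Jc'|apply: prime_productM].
Qed.

End OreStep.

(** * Hilbert's basis theorem for a subring extended by one element *)
Section Noetherian.
Variable A : comNzRingType.

Record ideal_in (S : {pred A}) (I : A -> Prop) : Prop := {
  ideal_in_sub : forall a, I a -> a \in S;
  ideal_in0 : I 0;
  ideal_inD : forall a b, I a -> I b -> I (a + b);
  ideal_inM : forall a b, a \in S -> I b -> I (a * b) }.

(** Linear combinations with coefficients in S, consumed from the head of the
    list: the division algorithm below subtracts one generator at a time. *)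
Fixpoint combination (S : {pred A}) (l : seq A) (a : A) : Prop :=
  if l is b :: l' then exists2 c, c \in S & combination S l' (a - c * b) else a = 0.

Definition finitely_generated (S : {pred A}) (I : A -> Prop) : Prop :=
  exists2 l, (forall b, b \in l -> I b) & (forall a, I a -> combination S l a).

Definition noetherian_subring (S : {pred A}) : Prop :=
  forall I, ideal_in S I -> finitely_generated S I.

Lemma combination0 (S : subringClosed A) l : combination S l 0.
Proof.
by elim: l => //= b l IHl; exists 0; rewrite ?rpred0 // mul0r subr0.
Qed.

Lemma combinationD (S : subringClosed A) l a b :
  combination S l a -> combination S l b -> combination S l (a + b).
Proof.
elim: l a b => /= [|g l IHl] a b; first by move=> -> ->; rewrite addr0.
move=> [c Sc ca] [e Se eb]; exists (c + e); first exact: rpredD.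
by have -> : a + b - (c + e) * g = (a - c * g) + (b - e * g) by [ring]; apply: IHl.
Qed.

Lemma combination_catl (S : subringClosed A) l l' a :
  combination S l a -> combination S (l ++ l') a.
Proof.
elim: l a => /= [|g l IHl] a; first by move=> ->; apply: combination0.
by move=> [c Sc /IHl ca]; exists c.
Qed.

Lemma combination_catr (S : subringClosed A) l l' a :
  combination S l' a -> combination S (l ++ l') a.
Proof.
move=> ca; elim: l => //= g l IHl; exists 0; first exact: rpred0.
by rewrite mul0r subr0.
Qed.

Lemma combination_sum (S : {pred A}) l a : combination S l a ->
  exists c : nat -> A, a = \sum_(i < size l) c i * l`_i.
Proof.
elim: l a => /= [|g l IHl] a; first by move=> ->; exists (fun=> 0); rewrite big_ord0.
move=> [c _ /IHl[e ea]]; exists (fun i => if i is i'.+1 then e i' else c).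
by rewrite big_ord_recl /= -ea; ring.
Qed.

Lemma noetherian_setT (S : {pred A}) : (forall a, a \in S) ->
  noetherian_subring S -> noetherian A.
Proof.
move=> ST noethS I II; have [|l lI Il] := noethS I.
  by split=> // [|a b|a b _]; [exact: ideal_zero II|exact: ideal_add|exact: ideal_mul].
exists (size l), (fun i => l`_i) => a; split=> [/Il/combination_sum[c ->]|[c ->]].
  by exists (fun i => c i).
elim/big_ind: _ => [|? ?|i _]; [exact: ideal_zero II|exact: ideal_add|].
by apply: (ideal_mul II); apply/lI/mem_nth.
Qed.

Section HilbertBasis.
Variables (B R : subringClosed A) (x : A).
Hypothesis sBR : {subset B <= R}.
Hypothesis xR : x \in R.
Hypothesis R_poly : forall f, f \in R -> exists2 p, p \is a polyOver B & f = p.[x].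

Section Ideal.
Variable I : A -> Prop.
Hypothesis RI : ideal_in R I.

Definition bounded n (p : {poly A}) : Prop :=
  [/\ p \is a polyOver B, (size p <= n)%N & I p.[x]].

Lemma boundedD n p q : bounded n p -> bounded n q -> bounded n (p + q).
Proof.
move=> [Bp sp Ip] [Bq sq Iq]; split; [exact: rpredD| |].
  by rewrite (leq_trans (size_polyD _ _)) // geq_max sp.
by rewrite hornerD; apply: (ideal_inD RI).
Qed.

Lemma boundedCM n c p : c \in B -> bounded n p -> bounded n (c%:P * p).
Proof.
move=> Bc [Bp sp Ip]; split; first by rewrite rpredM // polyOverC.
  by apply/leq_sizeP=> i ni; rewrite coefCM nth_default ?mulr0 // (leq_trans sp).
by rewrite hornerM hornerC; apply: (ideal_inM RI); rewrite ?sBR.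
Qed.

Lemma boundedXnM n k p : bounded n p -> bounded (n + k) ('X^k * p).
Proof.
move=> [Bp sp Ip]; split; first by rewrite rpredM ?rpredX ?polyOverX.
  apply/leq_sizeP=> i ni; rewrite coefXnM; case: ltnP => // ki.
  by rewrite nth_default // (leq_trans sp) // leq_subRL // addnC.
by rewrite hornerM hornerXn; apply: (ideal_inM RI); rewrite ?rpredX.
Qed.

Definition lead_at n b : Prop := exists2 p, bounded n.+1 p & p`_n = b.

Lemma lead_at_shift n k b : lead_at n b -> lead_at (n + k) b.
Proof.
move=> [p bp <-]; exists ('X^k * p); first by rewrite -addSn; apply: boundedXnM.
by rewrite coefXnM ltnNge leq_addl /= addnK.
Qed.

Lemma lead_at_ideal n : ideal_in B (lead_at n).
Proof.
split.
- by move=> _ [p [/polyOverP Bp _ _] <-].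
- exists 0; last by rewrite coef0.
  by split; rewrite ?rpred0 ?size_poly0 // horner0; apply: ideal_in0 RI.
- by move=> _ _ [p bp <-] [q bq <-]; exists (p + q); [exact: boundedD|rewrite coefD].
- by move=> c _ Bc [p bp <-]; exists (c%:P * p); [exact: boundedCM|rewrite coefCM].
Qed.

Definition lead_ideal b : Prop := exists n, lead_at n b.

Lemma lead_idealP : ideal_in B lead_ideal.
Proof.
split.
- by move=> b [n]; apply: ideal_in_sub (lead_at_ideal n) b.
- by exists 0%N; apply: ideal_in0 (lead_at_ideal 0).
- move=> a b [n La] [m Lb]; exists (n + m)%N; apply: (ideal_inD (lead_at_ideal _)).
    exact: lead_at_shift.
  by rewrite addnC; apply: lead_at_shift.
- by move=> a b Ba [n Lb]; exists n; apply: (ideal_inM (lead_at_ideal n)).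
Qed.

Lemma lead_lift n (l : seq A) : (forall b, b \in l -> lead_at n b) ->
  exists2 lp, (forall p, p \in lp -> bounded n.+1 p) & [seq p`_n | p : {poly A} <- lp] = l.
Proof.
elim: l => [|b l IHl] lL; first by exists [::].
have [p bp pb] : lead_at n b by apply: lL; rewrite mem_head.
have [c lc|lp blp elp] := IHl; first by apply: lL; rewrite inE lc orbT.
exists (p :: lp); last by rewrite /= pb elp.
by move=> q; rewrite inE => /orP[/eqP->|/blp].
Qed.

Lemma lead_uniform (l : seq A) : (forall b, b \in l -> lead_ideal b) ->
  exists n, forall b, b \in l -> lead_at n b.
Proof.
elim: l => [|b l IHl] lL; first by exists 0%N.
have [m Lb] : lead_ideal b by apply: lL; rewrite mem_head.
have [c lc|n nL] := IHl; first by apply: lL; rewrite inE lc orbT.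
exists (n + m)%N => c; rewrite inE => /orP[/eqP->|/nL]; last exact: lead_at_shift.
by rewrite addnC; apply: lead_at_shift.
Qed.

(** A combination of the leading coefficients of the polynomials in [lp], with
    each of them multiplied by X^k, cancels the leading coefficient of f. *)
Lemma division n k lp f : (forall p, p \in lp -> bounded n.+1 p) ->
  bounded (n + k).+1 f -> combination B [seq p`_n | p : {poly A} <- lp] f`_(n + k) ->
  exists2 g, bounded (n + k) g &
             combination R [seq p.[x] | p : {poly A} <- lp] (f.[x] - g.[x]).
Proof.
elim: lp f => /= [|p lp IHlp] f blp bf.
  move=> f0; exists f; last exact: subrr.
  have [Bf sf If] := bf; split=> //; apply/leq_sizeP=> i.
  by rewrite leq_eqVlt => /orP[/eqP<-//|ni]; rewrite nth_default // (leq_trans sf).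
move=> [c Bc cf]; have bp : bounded n.+1 p by apply: blp; rewrite mem_head.
have [|||g bg cg] := IHlp (f - c%:P * ('X^k * p)).
- by move=> q lq; apply: blp; rewrite inE lq orbT.
- rewrite -mulNr -polyCN; apply: boundedD => //; apply: boundedCM; rewrite ?rpredN //.
  by rewrite -addSn; apply: boundedXnM.
- by rewrite coefB coefCM coefXnM ltnNge leq_addl /= addnK.
exists g => //; exists (c * x ^+ k); first by rewrite rpredM ?rpredX //; apply: sBR.
rewrite (_ : _ - _ = (f - c%:P * ('X^k * p)).[x] - g.[x]) //.
by rewrite hornerD hornerN !hornerM hornerC hornerXn; ring.
Qed.

(** The elements of I of degree less than n: their leading coefficients in
    degree n - 1 form an ideal of B, and dividing by lifts of its generators
    lowers the degree bound. *)
Lemma bounded_generated : noetherian_subring B -> forall n,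
  exists2 l, (forall b, b \in l -> I b) &
             (forall f, bounded n f -> combination R l f.[x]).
Proof.
move=> noethB; elim=> [|n [l lI Il]].
  exists [::] => // f [_ + _]; rewrite leqn0 size_poly_eq0 => /eqP->.
  by rewrite horner0.
have [_ /lead_lift[lp blp <-] Lm] := noethB _ (lead_at_ideal n).
exists ([seq p.[x] | p : {poly A} <- lp] ++ l) => [b|f bf].
  by rewrite mem_cat => /orP[/mapP[p /blp[_ _ Ip] ->]|/lI].
have [||g] := @division n 0 lp f blp; rewrite ?addn0 //.
  by apply: Lm; exists f.
move=> bg cfg; rewrite -[f.[x]](subrK g.[x]).
by apply: combinationD; [exact: combination_catl|apply/combination_catr/Il].
Qed.

(** Finitely many generators of the ideal of all leading coefficients are lifted
    to polynomials of one degree n. Division by them reduces elements of degree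
    at least n to lower degree, where [bounded_generated] takes over. *)
Lemma hilbert_ideal : noetherian_subring B -> finitely_generated R I.
Proof.
move=> noethB; have [l /lead_uniform[n nL] Lm] := noethB _ lead_idealP.
have [lp blp elp] := lead_lift nL.
have [low lowI Ilow] := bounded_generated noethB n.
exists ([seq p.[x] | p : {poly A} <- lp] ++ low) => [b|a Ia].
  by rewrite mem_cat => /orP[/mapP[p /blp[_ _ Ip] ->]|/lowI].
have [p Bp ea] := R_poly (ideal_in_sub RI Ia); rewrite ea in Ia *.
have : bounded (n + size p) p by split; rewrite ?leq_addl.
move: (size p) => k; elim: k p {Bp ea Ia} => [|k IHk] p bp.
  by apply/combination_catr/Ilow; rewrite addn0 in bp.
rewrite addnS in bp; have [|g bg cfg] := division blp bp.
  by rewrite elp; apply: Lm; exists (n + k)%N, p.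
rewrite -[p.[x]](subrK g.[x]); apply: combinationD; last exact: IHk.
exact: combination_catl.
Qed.

End Ideal.

Theorem hilbert_step : noetherian_subring B -> noetherian_subring R.
Proof. by move=> noethB I RI; apply: hilbert_ideal. Qed.

End HilbertBasis.
End Noetherian.

(** * Characters and weights of the torus *)
Section Characters.
Variables (K : fieldType) (G : groupType).

Definition character (chi : G -> K) : Prop :=
  chi 1%g = 1 /\ forall g h, chi (g * h)%g = chi g * chi h.

(** Artin's argument for the independence of characters, relative to a subspace
    P. Comparing the hypothesis at g0 g with its multiple by F i g0 at g removes
    the i-th term and multiplies v by the nonzero scalar chi g0 - F i g0. The
    characters F i only have to differ from chi, not from each other. *)
Lemma character_separation (V : lmodType K) (P : V -> Prop) (I : eqType)
    (s : seq I) (F : I -> G -> K) (chi : G -> K) (v : V) (w : I -> V) :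
  (forall (k : K) a b, P a -> P b -> P (k *: a + b)) -> character chi ->
  (forall i, i \in s -> character (F i)) ->
  (forall i, i \in s -> exists g, F i g != chi g) ->
  (forall g, P (chi g *: v + \sum_(i <- s) F i g *: w i)) -> P v.
Proof.
move=> Plin [chi1 chiM]; elim: s v w => [|i s IHs] v w Fchar Fneq Psum.
  by have := Psum 1%g; rewrite big_nil addr0 chi1 scale1r.
have [g0 g0P] := Fneq i (mem_head _ _); have [Fi1 FiM] := Fchar i (mem_head _ _).
have P0 : P 0 by rewrite -[0](addNr (chi 1%g *: v + \sum_(j <- i :: s) F j 1%g *: w j)) -scaleN1r; apply: Plin.
have PZ (k : K) a : P a -> P (k *: a) by move=> Pa; rewrite -[k *: a]addr0; apply: Plin.
suff : P ((chi g0 - F i g0) *: v).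
  move/(PZ (chi g0 - F i g0)^-1); rewrite scalerA mulVf ?scale1r //.
  by rewrite subr_eq0 eq_sym.
apply: (IHs _ (fun j => (F j g0 - F i g0) *: w j)) => [j sj|j sj|g].
- by apply: Fchar; rewrite inE sj orbT.
- by apply: Fneq; rewrite inE sj orbT.
have := Plin (- F i g0) _ _ (Psum g) (Psum (g0 * g)%g).
rewrite !big_cons chiM FiM; congr P.
have merge (c y z : K) (u : V) : - c *: (y *: u) + (z * y) *: u = y *: ((z - c) *: u).
  by rewrite !scalerA -scalerDl; congr (_ *: _); ring.
rewrite !scalerDr addrACA merge; congr (_ + _).
rewrite addrACA merge subrr scale0r scaler0 add0r scaler_sumr -big_split.
apply: eq_big_seq => j sj /=; have [|_ ->] := Fchar j; first by rewrite inE sj orbT.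
exact: merge.
Qed.

End Characters.

Section TorusCharacters.
Variables (K : fieldType) (r : nat).
Implicit Types (u v : {ffun 'I_r -> int}) (g h : torus K r).

Lemma torus_char_character u : character (@torus_char K r u).
Proof.
split=> [|g h]; rewrite /torus_char; last first.
  by rewrite -big_split; apply: eq_bigr => i _; rewrite ffunE /= expfzMl.
by rewrite big1 // => i _; rewrite ffunE /= exp1rz.
Qed.

Lemma torus_charD u v g : torus_char (u + v) g = torus_char u g * torus_char v g.
Proof.
rewrite /torus_char -big_split; apply: eq_bigr => i _.
by rewrite ffunE /= expfzDr ?kvalP.
Qed.

Lemma torus_char0 g : torus_char 0 g = 1.
Proof. by rewrite /torus_char big1 // => i _; rewrite ffunE expr0z. Qed.

Hypothesis charK0 : [pchar K] =i pred0.

Lemma two_neq0 : 2 != 0 :> K.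
Proof. by have /pcharf0P -> := charK0. Qed.

Lemma expz2_inj (m n : int) : (2 : K) ^ m = 2 ^ n -> m = n.
Proof.
have inj0 (k : nat) : (2 : K) ^+ k = 1 -> k = 0%N.
  case: k => // k e; have /pcharf0P Knat := charK0.
  have : ((2 ^ k.+1)%N%:R - 1%:R == 0 :> K) by rewrite natrX e subrr.
  rewrite -natrB ?expn_gt0 // Knat subn_eq0 leqNgt.
  by rewrite -[1%N](expn0 2) ltn_exp2l.
move=> e; have : (2 : K) ^ (m - n) = 1.
  by rewrite expfzDr ?two_neq0 // e -expfzDr ?two_neq0 // subrr expr0z.
case: (m - n) (subr_eq0 m n) => k ek.
  by rewrite -exprnP => /inj0 k0; apply/eqP; rewrite -ek k0.
by rewrite NegzE -exprnN => /eqP; rewrite invr_eq1 => /eqP/inj0.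
Qed.

(** The element with i-th coordinate 2 and all others 1 separates exponents that
    differ at i, as 2 has infinite order in characteristic 0. *)
Lemma torus_char_inj u v : u != v -> exists g, torus_char u g != torus_char v g.
Proof.
move=> /eqP ne_uv; apply: NNPP => no_g; apply: ne_uv; apply/ffunP => i.
pose g : torus K r := [ffun j => if j == i then MkKstar two_neq0 else 1%g].
have ev w : torus_char w g = 2 ^ w i.
  rewrite /torus_char (bigD1 i) //= ffunE eqxx big1 ?mulr1 // => j /negPf ji.
  by rewrite ffunE ji /= exp1rz.
apply: expz2_inj; rewrite -!ev; apply/eqP/negPn/negP => ne.
by apply: no_g; exists g.
Qed.

(** Regular functions on the torus with the terms in a list, which makes
    closure under linear combinations immediate. *)
Definition laurent (f : torus K r -> K) : Prop :=
  exists s : seq (K * {ffun 'I_r -> int}),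
    forall g, f g = \sum_(t <- s) t.1 * torus_char t.2 g.

Lemma laurent_regular f : torus_regular f -> laurent f.
Proof.
move=> [m [c [u fE]]]; exists [seq (c j, u j) | j <- index_enum 'I_m] => g.
by rewrite fE big_map.
Qed.

Lemma laurent_sum (I : Type) (s : seq I) (c : I -> K) (f : I -> torus K r -> K) :
  (forall i, laurent (f i)) -> laurent (fun g => \sum_(i <- s) c i * f i g).
Proof.
move=> fL; elim: s => [|i s [t tE]]; first by exists [::] => g; rewrite !big_nil.
have [t' t'E] := fL i; exists ([seq (c i * z.1, z.2) | z <- t'] ++ t) => g.
rewrite big_cons big_cat -tE big_map t'E mulr_sumr; congr (_ + _).
by apply: eq_bigr => z _; rewrite mulrA.
Qed.

(** Otherwise chi would be independent of the characters of the torus that occur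
    in its expansion. *)
Lemma laurent_character chi : character chi -> laurent chi ->
  exists u, forall g, chi g = torus_char u g.
Proof.
move=> chiP [s chiE]; apply: NNPP => no_u; case/eqP: (oner_neq0 K).
apply: (character_separation (V := K^o) (P := fun a => a = 0) (s := s)
  (F := fun t => torus_char t.2) (w := fun t => - t.1 : K^o) _ chiP).
- by move=> k a b -> ->; rewrite scaler0 addr0.
- by move=> t _; apply: torus_char_character.
- move=> t _; apply: NNPP => no_g; apply: no_u; exists t.2 => g.
  by apply/esym/eqP/negPn/negP => ne; apply: no_g; exists g.
move=> g; rewrite chiE -[_ *: _]/(_ * _) mulr1 -big_split big1 // => t _ /=.
by rewrite -[_ *: _]/(_ * _) mulrN mulrC subrr.
Qed.

End TorusCharacters.

Section Weights.
Variables (K : fieldType) (r : nat) (V : comAlgType K) (br : V -> V -> V).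
Variable act : torus K r -> V -> V.
Hypothesis actP : is_poisson_action br act.

(** In a finite-dimensional stable subspace containing a, a nonzero coordinate of
    a expresses the eigenvalue as a combination of matrix coefficients, which
    are regular functions. *)
Lemma eigenvector_weight a : rational_action act -> eigenvector act a ->
  exists u, weight_vector act u a.
Proof.
move=> ratl [a0 [chi actE]].
have [m [v [M [vfree [c ea] Mreg Mact]]]] := ratl a.
have [i ci] : exists i, c i != 0.
  apply: NNPP => no_i; case/eqP: a0; rewrite ea big1 // => i _.
  have [->|ci] := eqVneq (c i) 0; first by rewrite scale0r.
  by case: no_i; exists i.
have chi_eq g j : \sum_k c k * M g j k = chi g * c j.
  apply/eqP; rewrite -subr_eq0; apply/eqP; move: j.
  apply: vfree; under eq_bigr do rewrite scalerBl.
  rewrite sumrB; apply/eqP; rewrite subr_eq0; apply/eqP.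
  transitivity (act g a); last first.
    by rewrite actE ea scaler_sumr; apply: eq_bigr => j _; rewrite scalerA.
  rewrite ea (act_sum actP); under [RHS]eq_bigr do rewrite (actZ actP) Mact scaler_sumr.
  rewrite exchange_big; apply: eq_bigr => j _; rewrite scaler_suml.
  by apply: eq_bigr => k _; rewrite scalerA.
have chiP : character chi.
  have inj (k l : K) : k *: a = l *: a -> k = l.
    move/eqP; rewrite -subr_eq0 -scalerBl scaler_eq0 (negPf a0) orbF subr_eq0.
    by move/eqP.
  split=> [|g h]; apply: inj; first by rewrite -actE (act_one actP) scale1r.
  by rewrite -actE (act_mul actP) actE (actZ actP) actE scalerA mulrC.
have [u uE] : exists u, forall g, chi g = torus_char u g.
  apply: laurent_character => //.
  have := laurent_sum (index_enum 'I_m) (fun k => c k / c i) (fun k => laurent_regular (Mreg i k)).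
  move=> [s sE]; exists s => g; rewrite -sE.
  apply: (mulIf ci); rewrite -chi_eq mulr_suml; apply: eq_bigr => k _.
  by rewrite mulrAC divfK.
by exists u => g; rewrite actE uE.
Qed.

End Weights.

(** * The subalgebras of polynomials in the first variables *)
Section PolySub.
Variables (K : fieldType) (N : nat).
Local Notation A := {mpoly K[N]}.

Lemma mpoly_linear_ind (P : A -> Prop) :
  (forall (k : K) p q, P p -> P q -> P (k *: p + q)) ->
  (forall m, P 'X_[m]) -> forall p, P p.
Proof.
move=> Plin PX p; rewrite [p]mpolyE; elim/big_ind: _ => [|q q' Pq Pq'|m _].
- by rewrite -[0](addNr ('X_[0%MM] : A)) -scaleN1r; apply: (Plin).
- by rewrite -[q]scale1r; apply: (Plin).
rewrite -[_ *: _]addr0; apply: (Plin) => //.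
by rewrite -[0](addNr ('X_[0%MM] : A)) -scaleN1r; apply: (Plin).
Qed.

Lemma poly_subP k (p : A) :
  reflect (forall m, p@_m != 0 -> forall i : 'I_N, (k <= i)%N -> m i = 0%N)
          (p \in poly_sub k).
Proof.
apply: (iffP allP) => [pk m|pk m]; rewrite -?mcoeff_msupp => mp.
  by move=> i ki; have /forallP/(_ i) := pk m mp; rewrite ki => /eqP.
by apply/forallP=> i; apply/implyP=> ki; apply/eqP/pk => //; rewrite -mcoeff_msupp.
Qed.

Lemma poly_subring_closed k : subring_closed (@poly_sub K N k).
Proof.
split.
- apply/poly_subP=> m; rewrite mcoeff1; have [-> _ i _|_] := eqVneq m 0%MM; first by rewrite mnm0E.
  by rewrite eqxx.
- move=> p q /poly_subP pk /poly_subP qk; apply/poly_subP=> m.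
  rewrite mcoeffB => pq i ki; have [pm0|pm] := eqVneq p@_m 0; last exact: pk pm i ki.
  by apply: qk ki; apply: contraNneq pq => qm0; rewrite pm0 qm0 subrr.
move=> p q /poly_subP pk /poly_subP qk; apply/poly_subP=> m.
rewrite -mcoeff_msupp => /msuppM_le/allpairsP[[m1 m2] /= [m1p m2q ->]] i ki.
by rewrite mnmDE (pk m1) ?(qk m2) // -mcoeff_msupp.
Qed.

HB.instance Definition _ k :=
  GRing.isSubringClosed.Build A (@poly_sub K N k) (poly_subring_closed k).

Lemma poly_sub_alg k (c : K) : c%:A \in @poly_sub K N k.
Proof.
apply/poly_subP=> m; rewrite mcoeffZ mcoeff1; have [-> _ i _|_] := eqVneq m 0%MM.
  by rewrite mnm0E.
by rewrite mulr0 eqxx.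
Qed.

Lemma poly_sub_le k l : (k <= l)%N -> {subset @poly_sub K N k <= poly_sub l}.
Proof.
move=> kl p /poly_subP pk; apply/poly_subP=> m pm i li.
exact: pk pm i (leq_trans kl li).
Qed.

Lemma poly_sub_full (p : A) : p \in poly_sub N.
Proof. by apply/poly_subP=> m _ i; rewrite leqNgt ltn_ord. Qed.

Lemma poly_sub0 (p : A) : p \in poly_sub 0 -> exists c : K, p = c%:A.
Proof.
move=> /poly_subP p0; exists p@_0%MM; rewrite alg_mpolyC.
apply/mpolyP=> m; rewrite mcoeffC; have [->|m0] := eqVneq m 0%MM; first by rewrite mulr1.
rewrite mulr0; apply: contraNeq m0 => /p0 pm; apply/eqP/mnmP=> i.
by rewrite mnm0E pm.
Qed.

Section PolyVariable.
Variable k : 'I_N.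

Lemma poly_sub_X : ('X_k : A) \in poly_sub k.+1.
Proof.
apply/poly_subP=> m; rewrite mcoeffX; have [<- _ i ki|_] := eqVneq U_(k)%MM m; last by rewrite eqxx.
by rewrite mnm1E; case: eqP ki => // ->; rewrite ltnn.
Qed.

Lemma poly_sub_expand (p : A) : p \in poly_sub k.+1 ->
  exists2 q, q \is a polyOver (poly_sub k) & p = q.['X_k].
Proof.
move=> /poly_subP pk; rewrite [p]mpolyE big_seq.
elim/big_ind: _ => [|_ _ [q Bq ->] [q' Bq' ->]|m mp].
- by exists 0; rewrite ?rpred0 ?horner0.
- by exists (q + q'); rewrite ?rpredD ?hornerD.
pose m' := (m - U_(k) *+ m k)%MM.
have em : m = (m' + U_(k) *+ m k)%MM.
  rewrite submK //; apply/mnm_lepP=> i; rewrite mulmnE mnm1E.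
  by case: eqP => [<-|_]; rewrite ?mul1n ?mul0n.
exists ((p@_m *: 'X_[m'])%:P * 'X^(m k)); last first.
  by rewrite hornerM hornerC hornerXn mpolyXn -scalerAl -mpolyXD -em.
rewrite rpredM ?rpredX ?polyOverX // polyOverC.
apply/poly_subP=> n; rewrite mcoeffZ mcoeffX; have [<- _ i ki|_] := eqVneq m' n; last first.
  by rewrite mulr0 eqxx.
rewrite /m' mnmBE mulmnE mnm1E; case: eqP => [<-|ne_ki]; first by rewrite mul1n subnn.
rewrite mul0n subn0 (pk m) -?mcoeff_msupp // ltn_neqAle ki andbT.
by apply/eqP=> e; apply/ne_ki/val_inj.
Qed.

Lemma mcoeff_mul_Xn (p : A) j m :
  (p * 'X_k ^+ j)@_m = if (j <= m k)%N then p@_(m - U_(k) *+ j) else 0.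
Proof.
rewrite mpolyXn; have ejk : (U_(k) *+ j)%MM k = j by rewrite mulmnE mnm1E eqxx mul1n.
case: leqP => [le_jm|lt_mj].
  rewrite -{1}(@submK _ (U_(k) *+ j)%MM m); first by rewrite addmC mcoeffMX.
  apply/mnm_lepP=> i; rewrite mulmnE mnm1E.
  by case: eqP => [<-|_]; rewrite ?mul1n ?mul0n.
apply: memN_msupp_eq0; rewrite (perm_mem (msuppMX _ _)).
apply/mapP=> -[n _ em]; move: lt_mj; rewrite em mnmDE ejk.
by rewrite ltnNge leq_addr.
Qed.

(** The monomials of q`_j do not involve X_k, so the coefficient of q`_j at m is
    that of q(X_k) at the monomial m X_k^j. *)
Lemma poly_sub_free (q : {poly A}) : q \is a polyOver (poly_sub k) ->
  q.['X_k] = 0 -> q = 0.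
Proof.
move=> /polyOverP Bq q0; apply/polyP=> j; rewrite coef0; apply/mpolyP=> m.
rewrite mcoeff0; have [mk|mk] := eqVneq (m k) 0%N; last first.
  by apply: contraNeq mk; have /poly_subP qj := Bq j => /qj/(_ k (leqnn _)) ->.
have [jq|qj] := ltnP j (size q); last by rewrite nth_default // mcoeff0.
have := congr1 (mcoeff (m + U_(k) *+ j)%MM) q0.
rewrite horner_coef raddf_sum /= mcoeff0 (bigD1 (Ordinal jq)) //= big1 => [|[i iq]].
  rewrite addr0 mcoeff_mul_Xn mnmDE mulmnE mnm1E eqxx mul1n leq_addl.
  by rewrite addmK.
rewrite -val_eqE /= => ne_ij; rewrite mcoeff_mul_Xn mnmDE mulmnE mnm1E eqxx mul1n mk add0n.
case: leqP => // le_ij; apply: contraNeq ne_ij => qm.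
have /poly_subP/(_ _ qm k (leqnn _)) := Bq i.
rewrite mnmBE mnmDE !mulmnE !mnm1E eqxx !mul1n mk add0n => /eqP.
by rewrite subn_eq0 => le_ji; rewrite eqn_leq le_ij.
Qed.

End PolyVariable.

Lemma mpoly_domain : domain A.
Proof. by move=> p q /eqP; rewrite mulf_eq0 => /orP[/eqP|/eqP]; [left|right]. Qed.

Lemma noetherian_poly_sub k : (k <= N)%N -> noetherian_subring (@poly_sub K N k).
Proof.
elim: k => [_|k IHk ltkN].
  move=> I RI; have [[a Ia a0]|I0] := classic (exists2 a, I a & a != 0); last first.
    exists [::] => // a Ia; apply/eqP/negPn/negP=> a0; apply: I0; by exists a.
  exists [:: a] => [b|b Ib]; first by rewrite inE => /eqP->.
  have [c ec] := poly_sub0 (ideal_in_sub RI Ia).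
  have c0 : c != 0 by apply: contraNneq a0 => c0; rewrite ec c0 scale0r.
  exists (b * c^-1%:A).
    by rewrite rpredM ?poly_sub_alg //; apply: ideal_in_sub RI b Ib.
  by rewrite /= ec -mulrA -scalerAl mul1r scalerA mulVf // scale1r mulr1 subrr.
apply: (@hilbert_step _ (poly_sub (Ordinal ltkN)) (poly_sub k.+1) 'X_(Ordinal ltkN)).
- exact: poly_sub_le.
- exact: (poly_sub_X (Ordinal ltkN)).
- exact: (@poly_sub_expand (Ordinal ltkN)).
exact: IHk (ltnW ltkN).
Qed.

Lemma noetherian_mpoly : noetherian A.
Proof. exact: noetherian_setT poly_sub_full (noetherian_poly_sub (leqnn N)). Qed.

End PolySub.

(** * The action of the Lie algebra of the torus *)
Section CGLWeights.
Variables (K : fieldType) (N r : nat).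
Local Notation A := {mpoly K[N]}.
Hypothesis charK0 : [pchar K] =i pred0.
Variables (br : A -> A -> A) (act : torus K r -> A -> A).
Hypotheses (brP : is_poisson br) (actP : is_poisson_action br act).
Variable u : 'I_N -> {ffun 'I_r -> int}.
Hypothesis uP : forall k, weight_vector act (u k) 'X_k.

Definition weight (m : 'X_{1..N}) : {ffun 'I_r -> int} := \sum_i u i *+ m i.

Lemma weightD m n : weight (m + n) = weight m + weight n.
Proof. by rewrite -big_split; apply: eq_bigr => i _; rewrite mnmDE mulrnDr. Qed.

Lemma weight_vectorM v w a b :
  weight_vector act v a -> weight_vector act w b -> weight_vector act (v + w) (a * b).
Proof.
move=> va wb g; rewrite (act_ringM actP) va wb torus_charD.
by rewrite -scalerAl -scalerAr scalerA.
Qed.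

Lemma weight_vector1 : weight_vector act 0 1.
Proof. by move=> g; rewrite (act_ring1 actP) torus_char0 scale1r. Qed.

Lemma weight_mono m : weight_vector act (weight m) 'X_[m].
Proof.
rewrite mpolyXE_id /weight; elim/big_rec2: _ => [|i v a _ va]; first exact: weight_vector1.
apply: weight_vectorM va; elim: (m i) => [|n IHn]; first exact: weight_vector1.
by rewrite exprS mulrS; apply: weight_vectorM.
Qed.

Section Lie.
Variables (xi : 'rV[K]_r) (D : {linear A -> A}).
Hypothesis DP : lie_action act xi D.

Definition pairing (v : {ffun 'I_r -> int}) : K := \sum_i (v i)%:~R * xi 0 i.

Lemma pairingD v w : pairing (v + w) = pairing v + pairing w.
Proof.
by rewrite -big_split; apply: eq_bigr => i _; rewrite ffunE intrD mulrDl.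
Qed.

Lemma D_weight v a : weight_vector act v a -> D a = pairing v *: a.
Proof. exact: DP. Qed.

Lemma D_mono m : D 'X_[m] = pairing (weight m) *: 'X_[m].
Proof. exact/D_weight/weight_mono. Qed.

(** On monomials this is additivity of weights. *)
Lemma lie_mul p q : D (p * q) = D p * q + p * D q.
Proof.
elim/mpoly_linear_ind: p => [k p p' Hp Hp'|m].
  rewrite mulrDl -scalerAl linearP Hp Hp' [D (k *: p + p')]linearP /=.
  by rewrite mulrDl -scalerAl !mulrDl -!scalerAl scalerDr addrACA.
elim/mpoly_linear_ind: q => [k q q' Hq Hq'|n].
  rewrite mulrDr -scalerAr linearP Hq Hq' [D (k *: q + q')]linearP /=.
  by rewrite !mulrDr -!scalerAr scalerDr addrACA.
rewrite -mpolyXD !D_mono weightD pairingD scalerDl mpolyXD.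
by rewrite -scalerAl -scalerAr.
Qed.

Lemma weight_vector_br v w a b :
  weight_vector act v a -> weight_vector act w b -> weight_vector act (v + w) (br a b).
Proof.
move=> va wb g; rewrite (act_br actP) va wb torus_charD.
by rewrite (brZl brP) (brZr brP) scalerA.
Qed.

Lemma lie_br p q : D (br p q) = br (D p) q + br p (D q).
Proof.
elim/mpoly_linear_ind: p => [k p p' Hp Hp'|m].
  rewrite (br_linear_l brP) linearP Hp Hp' [D (k *: p + p')]linearP /=.
  by rewrite !(br_linear_l brP) scalerDr addrACA.
elim/mpoly_linear_ind: q => [k q q' Hq Hq'|n].
  rewrite (br_linear_r brP) linearP Hq Hq' [D (k *: q + q')]linearP /=.
  by rewrite !(br_linear_r brP) scalerDr addrACA.
rewrite !D_mono (D_weight (weight_vector_br (weight_mono m) (weight_mono n))).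
by rewrite pairingD scalerDl (brZl brP) (brZr brP).
Qed.

Lemma lie_act g p : D (act g p) = act g (D p).
Proof.
elim/mpoly_linear_ind: p => [k p p' Hp Hp'|m].
  by rewrite (act_linear actP) !linearP Hp Hp' (act_linear actP).
by rewrite D_mono (actZ actP) weight_mono linearZ /= D_mono !scalerA mulrC.
Qed.

Lemma mpoly_act g p :
  act g p = \sum_(m <- msupp p) torus_char (weight m) g *: (p@_m *: 'X_[m]).
Proof.
rewrite {1}[p]mpolyE (act_sum actP); apply: eq_bigr => m _.
by rewrite (actZ actP) weight_mono !scalerA mulrC.
Qed.

Lemma act_poly_sub k g p : p \in poly_sub k -> act g p \in poly_sub k.
Proof.
move=> /poly_subP pk; rewrite mpoly_act big_seq; apply: rpred_sum => m mp.
rewrite scalerA; apply/poly_subP=> n; rewrite mcoeffZ mcoeffX.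
have [<- _|_] := eqVneq m n; last by rewrite mulr0 eqxx.
by apply: pk; rewrite -mcoeff_msupp.
Qed.

(** By independence of characters V contains the weight components of its
    elements, and D is a scalar on each of them. *)
Lemma lie_stable (V : A -> Prop) :
  (forall (k : K) a b, V a -> V b -> V (k *: a + b)) ->
  (forall g a, V a -> V (act g a)) -> forall a, V a -> V (D a).
Proof.
move=> Vlin Vact p Vp.
have V0 : V 0 by rewrite -[0](addNr p) -scaleN1r; apply: Vlin.
have VZ (k : K) a : V a -> V (k *: a) by move=> Va; rewrite -[k *: a]addr0; apply: Vlin.
have VD a b : V a -> V b -> V (a + b) by move=> Va Vb; rewrite -[a]scale1r; apply: Vlin.
pose comp v := \sum_(m <- msupp p | weight m == v) p@_m *: 'X_[m] : A.
have Vcomp v : V (comp v).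
  apply: (character_separation (s := [seq m <- msupp p | weight m != v])
    (F := fun m => torus_char (weight m)) (w := fun m => p@_m *: 'X_[m])
    Vlin (torus_char_character K v)) => [m _|m|g].
  - exact: torus_char_character.
  - by rewrite mem_filter => /andP[/(torus_char_inj charK0)].
  have := Vact g p Vp; congr V; rewrite mpoly_act (bigID (fun m => weight m == v)) /=.
  rewrite big_filter /comp scaler_sumr; congr (_ + _).
  by apply: eq_bigr => m /eqP->.
have -> : D p = \sum_(v <- undup [seq weight m | m <- msupp p]) pairing v *: comp v.
  rewrite {1}[p]mpolyE linear_sum /=.
  under [RHS]eq_bigr do rewrite /comp scaler_sumr.
  rewrite (exchange_big_dep xpredT) //=; apply: eq_big_seq => m mp.
  rewrite linearZ /= D_mono -big_filter.
  have -> : [seq v <- undup [seq weight m0 | m0 <- msupp p] | weight m == v] = [:: weight m].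
    rewrite (eq_filter (a2 := pred1 (weight m))); last by move=> v /=; rewrite eq_sym.
    by rewrite filter_pred1_uniq ?undup_uniq // mem_undup map_f.
  by rewrite big_seq1 !scalerA mulrC.
elim/big_ind: _ => // v _; exact/VZ/Vcomp.
Qed.

End Lie.
End CGLWeights.

Lemma finite_choice (n : nat) (T : Type) (P : 'I_n -> T -> Prop) :
  (forall i, exists t, P i t) -> exists f, forall i, P i (f i).
Proof.
elim: n P => [|n IHn] P exP.
  have f : 'I_0 -> T by case.
  by exists f => -[].
have [f fP] := IHn _ (fun i => exP (lift ord0 i)); have [t tP] := exP ord0.
exists (fun i => oapp f t (unlift ord0 i)) => i.
by case: unliftP => [j ->|->] /=.
Qed.

(** * Poisson-CGL extensions *)
Section CGL.
Variables (K : fieldType) (N r : nat).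
Local Notation A := {mpoly K[N]}.
Hypothesis charK0 : [pchar K] =i pred0.
Variables (br : A -> A -> A) (sigma delta : 'I_N -> A -> A) (act : torus K r -> A -> A).
Hypothesis HR : poisson_CGL br sigma delta act.

(** Induction along the tower. In R_0 = K a nonzero ideal contains 1, the empty
    product. *)
Lemma CGL_prime_products k : (k <= N)%N -> meets_prime_products br act (poly_sub k).
Proof.
have brP := CGL_poisson HR; have actP := CGL_action HR.
have [u uP] : exists u, forall k, weight_vector act (u k) 'X_k.
  apply: (finite_choice (P := fun k v => weight_vector act v 'X_k)) => i.
  exact: (eigenvector_weight actP (CGL_rational HR) (CGL_eigen HR i)).
elim: k => [_|k IHk ltkN].
  move=> I SI [a Ia a0]; exists 1; last by exists [::]; rewrite ?big_nil.
  have [c ec] := poly_sub0 (stable_sub SI Ia).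
  have c0 : c != 0 by apply: contraNneq a0 => c0; rewrite ec c0 scale0r.
  rewrite -(scale1r 1) -(mulVf c0) -scalerA -ec.
  by rewrite -mulr_algl; apply: (stableM SI) Ia; apply: poly_sub_alg.
pose i : 'I_N := Ordinal ltkN.
have [xi [D [DP sD [lam lam0 DX]]]] := CGL_lie HR i.
have ore := CGL_ore HR i.
have [chi actX] := (CGL_eigen HR i).2.
apply: (ore_step (B := poly_sub i) (R := poly_sub k.+1) (x := 'X_i) (h := D) (d := delta i)
  charK0 (@mpoly_domain K N) brP actP _ _ _ _ _ _ _ _ _ _ _ _ _ _ _ lam0 DX actX).
- exact: poly_sub_alg.
- by move=> g b; apply: (act_poly_sub actP uP).
- by move=> g b; apply: (act_poly_sub actP uP).
- exact: poly_sub_le.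
- exact: (poly_sub_X K i).
- exact: (@poly_sub_expand _ _ i).
- exact: (@poly_sub_free _ _ i).
- exact: (lie_mul actP uP DP).
- exact: (lie_br brP actP uP DP).
- exact: (lie_act actP uP DP).
- exact: (lie_stable charK0 actP uP DP).
- exact: ore_base ore.
- exact: skew_derivation (ore_delta ore).
- move=> b Bb; case: (posnP i) => [i0|]; last by move/(CGL_nilpotent HR); apply.
  by exists 1%N; have [_ dB] := CGL_first HR i0 Bb; rewrite /= dB.
- by move=> b Bb; rewrite (ore_br ore Bb) sD.
exact: IHk (ltnW ltkN).
Qed.

(** For a product c b in P, the stable ideals (c) and (P : c) have their product
    in P. If (c) lies in P then c does, otherwise (P : c), which contains b,
    lies in P; so the number of factors can be lowered to one. *)
Lemma CGL_UFD : H_poisson_UFD br act.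
Proof.
have brP := CGL_poisson HR; have actP := CGL_action HR.
split=> //; first by split=> //; apply: mpoly_domain.
move=> P [[[PI Pbr] Pact] [a0 na0] Pprime] P_neq0.
pose S := @poly_sub K N N; have ST : forall a, a \in S by apply: poly_sub_full.
have Salg k : k%:A \in S by [].
have SP : stable_ideal br act S P.
  split=> // [|a b|a b _|a b _]; [exact: ideal_zero PI|exact: (ideal_add PI)|exact: (ideal_mul PI)|exact: Pbr].
have toH I : stable_ideal br act S I -> stable_poisson_ideal br act I.
  move=> SI; split; last exact: (stable_act SI).
  split; last by move=> a b; apply: (stable_br SI).
  by split=> [|a b|a b]; [exact: stable0 SI|exact: (stableD SI)|exact: (stableM SI)].
have [a Pa [s s_prime ea]] := CGL_prime_products (leqnn N) SP P_neq0.
suff [c sc Pc] : exists2 c, c \in s & P c.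
  have [[_ cbr cact] c0 c1 cM] := s_prime c sc.
  have divE b : principal c b <-> divides S c b.
    by split=> [[d ->]|[d _ ->]]; exists d.
  exists c; split=> //; split=> // [b|]; first by apply/divE/cbr.
  split=> [/divE//|b d /divE/(cM _ _ (ST b) (ST d))[]/divE]; by [left|right].
rewrite {a}ea in Pa; elim: s s_prime Pa => [|c s IHs] s_prime.
  by rewrite big_nil => P1; case: na0; rewrite -[a0]mulr1; apply: (ideal_mul PI).
have c_prime : prime_eigen br act S c by apply: s_prime; rewrite mem_head.
have s'_prime b : b \in s -> prime_eigen br act S b.
  by move=> sb; apply: s_prime; rewrite inE sb orbT.
rewrite big_cons => Pcs; have cN := prime_normal c_prime.
have SJ := stable_colon (S := S) brP actP Salg (fun g a _ => ST _) (fun a b _ _ => ST _) SP cN.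
have Sc := stable_principal (S := S) brP actP Salg (fun g a _ => ST _) (fun a b _ _ => ST _) cN.
have [b [m [e [f [ec fJ ->]]]]||] := Pprime _ _ (toH _ Sc) (toH _ SJ).
- elim/big_ind: _ => [|? ?|j _]; [exact: ideal_zero PI|exact: (ideal_add PI)|].
  have [y _ ->] := ec j; have [_ Pf] := fJ j.
  by rewrite mulrAC -mulrA; apply: (ideal_mul PI).
- move=> cP; exists c; first exact: mem_head.
  by apply: cP; exists 1; rewrite ?mul1r.
move=> JP; have [|b sb Pb] := IHs s'_prime; last by exists b; rewrite // inE sb orbT.
by apply: JP; split=> //; rewrite mulrC.
Qed.

End CGL.

Theorem theorem5p2 (K : fieldType) (charK0 : [pchar K]%R =i pred0) (N r : nat)
    (br : {mpoly K[N]} -> {mpoly K[N]} -> {mpoly K[N]})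
    (sigma delta : 'I_N -> {mpoly K[N]} -> {mpoly K[N]})
    (act : torus K r -> {mpoly K[N]} -> {mpoly K[N]})
    (HR : poisson_CGL br sigma delta act) :
  noetherian {mpoly K[N]} /\ H_poisson_UFD br act.
Proof. by split; [exact: noetherian_mpoly|exact: CGL_UFD charK0 _ _ _ _ HR]. Qed.
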